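(* Let $G(t)$ be the moment matrix of the deformed measure $d\mu_t=e^{t(z)}d\mu$ on $\mathbb{T}^D$, $t(z)=\sum_{\alpha\in\mathbb{Z}^D}t_\alpha z^\alpha$, for admissible times $t$. Then for all $\alpha,\alpha'\in\mathbb{Z}^D$: (1) The wave matrices solve the linear systems $$\frac{\partial W_1}{\partial t_\alpha}=B_\alpha W_1,\quad \frac{\partial\hat W_1}{\partial\bar t_{-\alpha}}=\hat B_\alpha\hat W_1,\quad \frac{\partial\hat W_2}{\partial t_\alpha}=B_\alpha\hat W_2,\quad \frac{\partial W_2}{\partial\bar t_{-\alpha}}=\hat B_\alpha W_2 .$$ (2) The Jacobi matrices are Lax matrices, i.e. they satisfy the Lax equations $$\frac{\partial J_\alpha}{\partial t_{\alpha'}}=[B_{\alpha'},J_\alpha],\qquad \frac{\partial\hat J_\alpha}{\partial\bar t_{-\alpha'}}=[\hat B_{\alpha'},\hat J_\alpha].$$ (3) The Zakharov–Shabat (zero-curvature) equations hold: $$\frac{\partial B_\alpha}{\partial t_{\alpha'}}-\frac{\partial B_{\alpha'}}{\partial t_\alpha}+[B_\alpha,B_{\alpha'}]=0,\qquad \frac{\partial\hat B_\alpha}{\partial\bar t_{-\alpha'}}-\frac{\partial\hat B_{\alpha'}}{\partial\bar t_{-\alpha}}+[\hat B_\alpha,\hat B_{\alpha'}]=0.$$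
   Context: Let $D\ge1$, $z(\theta)=(e^{i\theta_1},\dots,e^{i\theta_D})$. For $\alpha\in\mathbb{Z}^D$ put $|\alpha|=\sum_a|\alpha_a|$, $z^\alpha=\prod_a z_a^{\alpha_a}$, $[k]=\{\alpha:|\alpha|=k\}$. Multi-indices are ordered by $|\alpha|$ and lexicographically inside each $[k]$; $\chi(z)$ is the semi-infinite column of all monomials in this order. Semi-infinite matrices have the corresponding block structure $A_{[k],[l]}$; $A_\ge$ is the block upper triangular part of $A$ (including the block diagonal). $\mu$ is a complex Borel measure on $\mathbb{T}^D$ with moment matrix $G=\oint\chi(z(\theta))d\mu(\theta)\chi(z(\theta))^\dagger$. The times $t=(t_\alpha)_{\alpha\in\mathbb{Z}^D}$ form a family of complex parameters. Let $\Upsilon_\alpha$ be the matrix $(\Upsilon_\alpha)_{\beta,\gamma}=\delta_{\beta+\alpha,\gamma}$ and $W_0(t)=\exp(\sum_\alpha t_\alpha\Upsilon_\alpha)$; then $G(t)=W_0(t)G=GW_0(t)$. Times $t$ are admissible if $G(t)$ admits the block Gauss–Borel factorization $G(t)=S(t)^{-1}H(t)(\hat S(t)^{-1})^\dagger$ with $S,\hat S$ block lower unitriangular and $H$ block diagonal with invertible blocks (the factorization is then unique). All times considered are assumed admissible. The matrices $S,H$ depend on the $t_\alpha$, and $\hat S,H^\dagger$ on the conjugates $\bar t_\alpha$. Wave matrices: $W_1=S(t)W_0(t)$, $\hat W_1=\hat S(t)W_0(t)^\dagger$, $W_2=H(t)^\dagger(S(t)^{-1})^\dagger$, $\hat W_2=H(t)(\hat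 S(t)^{-1})^\dagger$. Jacobi matrices: $J_\alpha=S(t)\Upsilon_\alpha S(t)^{-1}$, $\hat J_\alpha=\hat S(t)\Upsilon_\alpha\hat S(t)^{-1}$. Zakharov–Shabat matrices: $B_\alpha=(J_\alpha)_\ge$, $\hat B_\alpha=(\hat J_\alpha)_\ge$. *)

(* Defs.v *)
From HB Require Import structures.
From mathcomp Require Import all_boot all_order all_algebra.
From mathcomp Require Import all_classical all_reals all_analysis.
From mathcomp Require Import complex zify.

Set Implicit Arguments.
Unset Strict Implicit.
Unset Printing Implicit Defensive.

Import Order.TTheory GRing.Theory Num.Theory.
Import numFieldNormedType.Exports.

Local Open Scope classical_set_scope.
Local Open Scope ring_scope.
Local Open Scope complex_scope.

(* The library puts the topology of the modulus on the alias R[i]^o only. *)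
#[warnings="-redundant-canonical-projection"]
HB.instance Definition _ (R : realType) := NormedModule.copy R[i] R[i]^o.

Definition cexp {R : realType} (z : R[i]) : R[i] :=
  (expR (complex.Re z))%:C * (cos (complex.Im z) +i* sin (complex.Im z)).

(* Rows and columns of semi-infinite matrices are labelled by the multi-indices
   in Z^D themselves rather than by their position in the graded lexicographic
   order.  The block [k] is the set of labels of degree k; the order inside a
   block plays no role in what follows. *)
Definition midx (D : nat) := {ffun 'I_D -> int}.
HB.instance Definition _ (D : nat) := GRing.Zmodule.on (midx D).

Definition mdeg {D : nat} (alpha : midx D) : nat :=
  (\sum_(a < D) `|alpha a|)%N.

(* Sums over Z^D are taken block after block, i.e. along the order of the
   semi-infinite columns; they are ordinary sums for finite supports. *)
Definition msum {R : realType} {D : nat} (f : midx D -> R[i]) : R[i] :=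
  lim ((fun n : nat =>
    \sum_(b \in [set b : midx D | (mdeg b <= n)%N]) f b) @ \oo).

(* \sum_(b \in A) is only meaningful for finite A. *)
Lemma finite_mdeg_le (D n : nat) :
  finite_set [set b : midx D | (mdeg b <= n)%N].
Proof.
pose f (g : {ffun 'I_D -> 'I_(n.*2.+1)}) : midx D :=
  [ffun a => (g a)%:Z - n%:Z].
apply: (@sub_finite_set _ _ (f @` setT)); last first.
  exact/finite_image/finite_finset.
move=> b /= bn.
have ba a : (absz (b a) <= n)%N.
  by apply: leq_trans bn; rewrite /mdeg (bigD1 a) //= leq_addr.
exists [ffun a => inord (absz (b a + n%:Z))] => //.
apply/ffunP => a; rewrite !ffunE.
have nb : 0 <= b a + n%:Z by have := ba a; lia.
rewrite inordK; first by rewrite gez0_abs // addrK.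
by have := ba a; lia.
Qed.

Section Matrices.
Context {R : realType} {D : nat}.

Definition smx := midx D -> midx D -> R[i].

Implicit Types A B : smx.

Definition sone : smx := fun b c => (b == c)%:R.

Definition smul A B : smx := fun b c => msum (fun d => A b d * B d c).

Definition sadj A : smx := fun b c => (A c b)^*.

Definition scomm A B : smx := fun b c => smul A B b c - smul B A b c.

Definition spow A (n : nat) : smx := iter n (smul A) sone.

Definition sexp A : smx := fun b c =>
  lim (series (fun n : nat => (n`!%:R)^-1 * spow A n b c) @ \oo).

(* Block upper triangular part, diagonal blocks included. *)
Definition supper A : smx := fun b c =>
  if (mdeg b <= mdeg c)%N then A b c else 0.

Definition blower_uni A : Prop := forall b c : midx D,
  (mdeg b <= mdeg c)%N -> A b c = (b == c)%:R.

Definition bdiag A : Prop := forall b c : midx D,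
  mdeg b <> mdeg c -> A b c = 0.

Definition block_inv A B (k : nat) : Prop :=
  forall b c : midx D, mdeg b = k -> mdeg c = k ->
    \sum_(d \in [set d : midx D | mdeg d = k]) A b d * B d c = (b == c)%:R.

Definition block_unit A (k : nat) : Prop :=
  exists B, block_inv A B k /\ block_inv B A k.

(* Inverse in the group of block lower unitriangular matrices. *)
Definition sinv A : smx :=
  xget sone [set B | [/\ blower_uni B, smul A B = sone & smul B A = sone]].

Definition gauss_borel (M S H hS : smx) : Prop :=
  [/\ blower_uni S, blower_uni hS, bdiag H, forall k, block_unit H k
    & M = smul (smul (sinv S) H) (sadj (sinv hS))].

Definition Upsilon (alpha : midx D) : smx := fun b c => (b + alpha == c)%:R.

(* Values t_alpha of the times, for all alpha in Z^D. *)
Definition times := midx D -> R[i].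

(* Summability is what makes t(z) an unordered pointwise sum on the torus
   (take z = 1), and W0 a well-defined exponential. *)
Definition times_summable (t : times) : Prop :=
  summable [set: midx D] (fun alpha => (complex.Re `|t alpha|)%:E).

Definition W0 (t : times) : smx :=
  sexp (fun b c => msum (fun alpha => t alpha * Upsilon alpha b c)).

Definition shift_time (t : times) (alpha : midx D) (h : R[i]) : times :=
  fun b => if b == alpha then t b + h else t b.

(* The matrix L is the partial derivative dF/dt_alpha at t of a matrix function
   F defined on a set T of times: the limit is taken entrywise, along the h
   for which the shifted times remain in T.  The admissible times of a coordinate
   line need not contain a neighbourhood of an admissible time, but only
   countably many h are excluded (the zeros of the leading block minors of the
   moment matrix, which are entire in h), so this limit is unique. *)
Definition is_dt (T : set times) (F : times -> smx) (alpha : midx D)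
    (t : times) (L : smx) : Prop :=
  forall b c, (F (shift_time t alpha h) b c - F t b c) / h
    @[h --> within [set h : R[i] | T (shift_time t alpha h)] 0^'] --> L b c.

(* The same for dF/d(conj t_alpha), F being a function of the conjugate times:
   F(t + h) = F(t) + L * conj h + o(h). *)
Definition is_dtbar (T : set times) (F : times -> smx) (alpha : midx D)
    (t : times) (L : smx) : Prop :=
  forall b c, (F (shift_time t alpha h) b c - F t b c) / h^*
    @[h --> within [set h : R[i] | T (shift_time t alpha h)] 0^'] --> L b c.

Definition wave1 (S : times -> smx) (t : times) : smx :=
  smul (S t) (W0 t).

Definition hwave1 (hS : times -> smx) (t : times) : smx :=
  smul (hS t) (sadj (W0 t)).

Definition wave2 (S H : times -> smx) (t : times) : smx :=
  smul (sadj (H t)) (sadj (sinv (S t))).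

Definition hwave2 (H hS : times -> smx) (t : times) : smx :=
  smul (H t) (sadj (sinv (hS t))).

(* Applied to S these are J and B, applied to hat S their hatted versions. *)
Definition jacobi (S : times -> smx) (alpha : midx D) (t : times) : smx :=
  smul (smul (S t) (Upsilon alpha)) (sinv (S t)).

Definition zakharov_shabat (S : times -> smx) (alpha : midx D) (t : times) :
  smx := supper (jacobi S alpha t).

End Matrices.

Arguments smx : clear implicits.
Arguments times : clear implicits.

Section Torus.
Context {R : realType} {D : nat}.

Definition torus : Type :=
  set_type [set z : 'rV[R[i]]_D | forall a, `|z ord0 a| = 1].

Lemma torus_one :
  const_mx 1 \in [set z : 'rV[R[i]]_D | forall a, `|z ord0 a| = 1].
Proof. by rewrite inE => a; rewrite mxE normr1. Qed.

HB.instance Definition _ := Topological.on torus.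
HB.instance Definition _ := isPointed.Build torus (SigSub torus_one).

(* T^D with its Borel sigma-algebra. *)
Definition borel_torus := g_sigma_algebraType (@open torus).

(* A complex Borel measure mu, given by the signed measures Re mu and Im mu. *)
Record complex_measure := ComplexMeasure {
  re_measure : {charge set borel_torus -> \bar R};
  im_measure : {charge set borel_torus -> \bar R} }.

Definition hahn_of (nu : {charge set borel_torus -> \bar R}) :
    {PN : set borel_torus * set borel_torus |
      hahn_decomposition nu PN.1 PN.2}.
Proof.
apply: cid; have [P [N h]] := Hahn_decomposition nu.
by exists (P, N).
Defined.

(* Integral against a signed measure, through its Jordan decomposition. *)
Definition charge_integral (nu : {charge set borel_torus -> \bar R})
    (f : borel_torus -> R) : R :=
  Rintegral (jordan_pos (svalP (hahn_of nu))) setT f -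
  Rintegral (jordan_neg (svalP (hahn_of nu))) setT f.

Definition complex_integral (mu : complex_measure) (f : torus -> R[i]) : R[i] :=
  (charge_integral (re_measure mu) (fun z => complex.Re (f z)) -
   charge_integral (im_measure mu) (fun z => complex.Im (f z))) +i*
  (charge_integral (re_measure mu) (fun z => complex.Im (f z)) +
   charge_integral (im_measure mu) (fun z => complex.Re (f z))).

Definition monomial (alpha : midx D) (z : torus) : R[i] :=
  \prod_(a < D) (val z) ord0 a ^ alpha a.

(* The Laurent series t(z). *)
Definition tfun (t : times R D) (z : torus) : R[i] :=
  msum (fun alpha => t alpha * monomial alpha z).

(* Moment matrix of the measure with density f with respect to mu: the entries
   of chi(z) chi(z)^dagger integrated against f(z) dmu. *)
Definition moment_matrix (mu : complex_measure) (f : torus -> R[i]) : smx R D :=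
  fun b c => complex_integral mu (fun z => monomial b z * (monomial c z)^* * f z).

(* Moment matrix G(t) of the deformed measure e^{t(z)} dmu. *)
Definition deformed_moments (mu : complex_measure) (t : times R D) : smx R D :=
  moment_matrix mu (fun z => cexp (tfun t z)).

Definition admissible (mu : complex_measure) (t : times R D) : Prop :=
  times_summable t /\
  exists S H hS : smx R D, gauss_borel (deformed_moments mu t) S H hS.

End Torus.

Arguments torus : clear implicits.
Arguments borel_torus : clear implicits.
Arguments complex_measure : clear implicits.

(* Main.v *)
Require Import Defs.
From HB Require Import structures.
From mathcomp Require Import all_boot all_order all_algebra.
From mathcomp Require Import finmap.
From mathcomp Require Import all_classical all_reals all_analysis measurable_realfun.
From mathcomp Require Import complex ring lra zify.

Set Implicit Arguments.
Unset Strict Implicit.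
Unset Printing Implicit Defensive.

Import Order.TTheory GRing.Theory Num.Theory.
Import numFieldNormedType.Exports.

Local Open Scope classical_set_scope.
Local Open Scope ring_scope.

(* Only the derivative of the moment matrix and of W0 in one time direction is
   analysis: e^(h z^alpha) = 1 + h z^alpha + O(h^2) uniformly on the torus gives
   dG = Upsilon_alpha G, and likewise dW0 = Upsilon_alpha W0.  The rest is linear
   algebra of row-finite matrices.  As S G is block upper triangular along the
   admissible times, the strictly lower part of (dS) G V + S (dG) V vanishes, where
   V is a block upper triangular right inverse of S G at the base point; since
   S (dG) V = S Upsilon_alpha S^-1 = J_alpha and (dS) G V = (dS) S^-1 is strictly
   lower, (dS) S^-1 = B_alpha - J_alpha.  On difference quotients the same identity
   is a finite linear system per row whose matrix tends to 1, so the derivative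
   exists along any set of admissible times.  The product rule then gives the wave
   and Lax equations, and the zero-curvature equations follow from the commutation
   of the J's.  The conjugate times are handled by the same argument applied to
   the adjoint factorization of G^dagger, with S and hat S exchanged. *)

(** * Limits in the complex numbers *)

(** [S], [H] and [hS] are arbitrary functions of the times that factor the moment matrix; no
    continuity is assumed, so the existence of their derivatives has to be extracted from that of
    [G]. Increments range over the admissible ones only; limits in the increment are therefore
    stated for arbitrary filters and never through [lim], which would require a proper filter. In
    each of the two families only one triangular factor is differentiated: since
    [S G = H (sadj (sinv hS))], the matrix [hwave2] is [S] times [G] just as [wave1] is [S] times
    [W0], and one product rule serves both. The moment matrix is in general neither row- nor
    column-finite, so [S G V] can be reassociated only because [S] is row-finite and [V]
    column-finite. Passing to adjoints alone would put [Upsilon alpha] to the right of [sadj G]; it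
    returns to the left because the entries of [G] and [W0] depend only on the difference of their
    indices. *)

(* The limit lemmas of the library do not unify in reasonable time at [R[i]], so
   limits are computed through real and imaginary parts. *)
Section ComplexLimits.
Context {R : realType}.
Local Open Scope complex_scope.
Implicit Types z w : R[i].

(** The l1 norm of the plane: real-valued, submultiplicative, and equivalent to the modulus with the
    constants of [norm1_le] and [Re_norm_le]. *)
Definition norm1 z : R := `|complex.Re z| + `|complex.Im z|.

Lemma norm1_ge0 z : 0 <= norm1 z.
Proof. by rewrite addr_ge0. Qed.

Lemma norm10 : norm1 0 = 0.
Proof. by rewrite /norm1 /= normr0 addr0. Qed.

Lemma ReD z w : complex.Re (z + w) = complex.Re z + complex.Re w.
Proof. by case: z w => [? ?] [? ?]. Qed.

Lemma ImD z w : complex.Im (z + w) = complex.Im z + complex.Im w.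
Proof. by case: z w => [? ?] [? ?]. Qed.

Lemma ReN z : complex.Re (- z) = - complex.Re z.
Proof. by case: z. Qed.

Lemma ImN z : complex.Im (- z) = - complex.Im z.
Proof. by case: z. Qed.

Lemma ReM z w :
  complex.Re (z * w) = complex.Re z * complex.Re w - complex.Im z * complex.Im w.
Proof. by case: z w => [? ?] [? ?]. Qed.

Lemma ImM z w :
  complex.Im (z * w) = complex.Re z * complex.Im w + complex.Im z * complex.Re w.
Proof. by case: z w => [? ?] [? ?]. Qed.

Lemma complexP z w :
  complex.Re z = complex.Re w -> complex.Im z = complex.Im w -> z = w.
Proof. by case: z w => [? ?] [? ?] /= -> ->. Qed.

Lemma norm1D z w : norm1 (z + w) <= norm1 z + norm1 w.
Proof.
rewrite /norm1 ReD ImD addrACA.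
by apply: lerD; apply: ler_normD.
Qed.

Lemma norm1N z : norm1 (- z) = norm1 z.
Proof. by rewrite /norm1 ReN ImN !normrN. Qed.

Lemma norm1M z w : norm1 (z * w) <= norm1 z * norm1 w.
Proof.
rewrite /norm1 ReM ImM mulrDl !mulrDr -!normrM.
rewrite [leRHS](_ : _ =
  (`|complex.Re z * complex.Re w| + `|complex.Im z * complex.Im w|) +
  (`|complex.Re z * complex.Im w| + `|complex.Im z * complex.Re w|)).
  by apply: lerD; [apply: ler_normB | apply: ler_normD].
by ring.
Qed.

Lemma norm1_sum (I : Type) (r : seq I) (P : pred I) (f : I -> R[i]) :
  norm1 (\sum_(i <- r | P i) f i) <= \sum_(i <- r | P i) norm1 (f i).
Proof.
elim/big_ind2: _ => [|x a y b xa yb|//]; first by rewrite norm10.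
exact: le_trans (norm1D _ _) (lerD xa yb).
Qed.

Lemma norm1_conj z : norm1 z^* = norm1 z.
Proof. by case: z => a b; rewrite /norm1 /= normrN. Qed.

Lemma norm1_le z : norm1 z <= 2 * complex.Re `|z|.
Proof.
rewrite normc_def /= mulr_natl mulr2n.
by apply: lerD; rewrite -sqrtr_sqr ler_wsqrtr // ?lerDl ?lerDr sqr_ge0.
Qed.

Lemma Re_norm_le z : complex.Re `|z| <= norm1 z.
Proof.
rewrite normc_def /= -[leRHS]ger0_norm ?norm1_ge0 // -sqrtr_sqr ler_wsqrtr //.
rewrite /norm1 sqrrD !real_normK ?num_real // addrAC lerDl.
by rewrite mulrn_wge0 // mulr_ge0.
Qed.

Lemma nbhs_complexP z (A : set R[i]) :
  nbhs z A <-> exists2 e : R, 0 < e & forall w, norm1 (w - z) < e -> A w.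
Proof.
have -> : nbhs z A <->
    exists2 e : R[i], 0 < e & forall w, `|z - w| < e -> A w by [].
split=> [[e e0 eA]|[e e0 eA]].
  have [Ie Re0] : complex.Im e = 0 /\ 0 < complex.Re e.
    by move: e0; rewrite ltcE /= => /andP[/eqP -> ->].
  exists (complex.Re e) => // w we; apply: eA.
  rewrite distrC normc_def ltcE /= Ie eqxx /=.
  by apply: le_lt_trans we; move: (Re_norm_le (w - z)); rewrite normc_def.
(* Halved because [norm1] is at most twice the modulus. *)
exists (e / 2)%:C => [|w].
  by rewrite ltcR divr_gt0.
rewrite distrC normc_def ltcR ltr_pdivlMr // mulrC => we.
by apply: eA; apply: le_lt_trans we; move: (norm1_le (w - z)); rewrite normc_def.
Qed.

Section Filtered.
Context {I : Type} {F : set_system I} {FF : Filter F}.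
Implicit Types f g : I -> R[i].

Lemma cvg_complexP f z : f @ F --> z <->
  forall e : R, 0 < e -> \forall x \near F, norm1 (f x - z) < e.
Proof.
split=> [fz e e0|fz A /nbhs_complexP[e e0 eA]].
  by apply: (fz [set w | norm1 (w - z) < e]); apply/nbhs_complexP; exists e.
by apply: filterS (fz e e0) => x; apply: eA.
Qed.

Lemma cvg_ReImP f z : f @ F --> z <->
  complex.Re (f x) @[x --> F] --> complex.Re z /\
  complex.Im (f x) @[x --> F] --> complex.Im z.
Proof.
split=> [/cvg_complexP h|[hr hi]].
  split; apply/cvgrPdist_lt => e /h; apply: filterS => x; apply: le_lt_trans;
    rewrite distrC /norm1 ReD ReN ImD ImN ?lerDl ?lerDr //.
apply/cvg_complexP => e e0.
have e20 : 0 < e / 2 by rewrite divr_gt0.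
move/cvgrPdist_lt : hr => /(_ _ e20); move/cvgrPdist_lt : hi => /(_ _ e20).
apply: filterS2 => x; rewrite distrC => hi; rewrite distrC => hr.
by rewrite /norm1 ReD ReN ImD ImN (splitr e) ltrD.
Qed.

Lemma cvgC_eq f z w : z = w -> f @ F --> z -> f @ F --> w.
Proof. by move=> ->. Qed.

Lemma cvgC_cst z : (fun=> z) @ F --> z.
Proof. by apply/cvg_ReImP; split; exact: cvg_cst. Qed.

Lemma cvgC_add f g z w :
  f @ F --> z -> g @ F --> w -> (fun x => f x + g x) @ F --> z + w.
Proof.
move=> /cvg_ReImP[f1 f2] /cvg_ReImP[g1 g2]; apply/cvg_ReImP.
rewrite ReD ImD; split; [under eq_cvg do rewrite ReD|under eq_cvg do rewrite ImD];
  exact: cvgD.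
Qed.

Lemma cvgC_opp f z : f @ F --> z -> (fun x => - f x) @ F --> - z.
Proof.
move=> /cvg_ReImP[f1 f2]; apply/cvg_ReImP.
rewrite ReN ImN; split; [under eq_cvg do rewrite ReN|under eq_cvg do rewrite ImN];
  exact: cvgN.
Qed.

Lemma cvgC_sub f g z w :
  f @ F --> z -> g @ F --> w -> (fun x => f x - g x) @ F --> z - w.
Proof. by move=> fz /cvgC_opp; exact: cvgC_add. Qed.

Lemma cvgC_mul f g z w :
  f @ F --> z -> g @ F --> w -> (fun x => f x * g x) @ F --> z * w.
Proof.
move=> /cvg_ReImP[f1 f2] /cvg_ReImP[g1 g2]; apply/cvg_ReImP.
rewrite ReM ImM; split; [under eq_cvg do rewrite ReM|under eq_cvg do rewrite ImM].
  by apply: cvgB; exact: cvgM.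
by apply: cvgD; exact: cvgM.
Qed.

Lemma cvgC_sum (J : Type) (r : seq J) (f : J -> I -> R[i]) (z : J -> R[i]) :
  (forall j, f j @ F --> z j) ->
  (fun x => \sum_(j <- r) f j x) @ F --> \sum_(j <- r) z j.
Proof.
move=> fz; elim: r => [|j r IH].
  rewrite big_nil [X in X @ _ --> _](_ : _ = fun=> 0); first exact: cvgC_cst.
  by apply/funext => x; rewrite big_nil.
rewrite big_cons [X in X @ _ --> _](_ : _ = fun x => f j x + \sum_(i <- r) f i x).
  exact: (cvgC_add (fz j) IH).
by apply/funext => x; rewrite big_cons.
Qed.

Lemma cvgC_conj f z : f @ F --> z -> (fun x => (f x)^*) @ F --> z^*.
Proof.
by move=> /cvg_complexP h; apply/cvg_complexP => e /h; apply: filterS => x;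
  rewrite -rmorphB /= norm1_conj.
Qed.

Lemma near_eq_cvgC f g z :
  (\forall x \near F, f x = g x) -> f @ F --> z -> g @ F --> z.
Proof.
move=> fg /cvg_complexP h; apply/cvg_complexP => e /h.
by apply: filterS2 fg => x ->.
Qed.

Lemma cvgC_bounded_mul0 (C : R) f g :
  (\forall x \near F, norm1 (f x) <= C) -> g @ F --> (0 : R[i]) ->
  (fun x => f x * g x) @ F --> (0 : R[i]).
Proof.
move=> fC /cvg_complexP g0; apply/cvg_complexP => e e0.
(* [C] may be negative: for an improper filter the bound on [f] says nothing. *)
have C0 : 0 < `|C| + 1 by rewrite ltr_wpDl.
have : 0 < e / (`|C| + 1) by rewrite divr_gt0.
move/g0; apply: filterS2 fC => x fC; rewrite !subr0 ltr_pdivlMr // mulrC => ge.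
apply: le_lt_trans (norm1M _ _) (le_lt_trans _ ge).
rewrite ler_wpM2r ?norm1_ge0 // (le_trans fC) // (le_trans (ler_norm C)) //.
by rewrite lerDl.
Qed.

End Filtered.

(** Uniqueness of the limit needs a proper filter; this serves the sums and series along [\oo]. *)
Lemma cvgC_lim (I : Type) (F : set_system I) (FF : ProperFilter F)
  (f : I -> R[i]) z : f @ F --> z -> lim (f @ F) = z.
Proof.
move=> fz; have fl : f @ F --> lim (f @ F) := cvgP _ fz.
move/cvg_ReImP : fz => [zr zi]; move/cvg_ReImP : fl => [lr li].
apply: complexP.
  by rewrite -(cvg_lim _ zr) // -(cvg_lim _ lr).
by rewrite -(cvg_lim _ zi) // -(cvg_lim _ li).
Qed.

End ComplexLimits.

(** * Semi-infinite matrices *)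

(* [smul] is locked, since unfolding it makes unification diverge. *)
HB.lock Definition mmul {R : realType} {D : nat} (A B : smx R D) : smx R D :=
  smul A B.

Section SemiInfinite.
Context {R : realType} {D : nat}.
Local Open Scope complex_scope.
Implicit Types (A B C : smx R D) (b c d : midx D) (k m n : nat).

Definition ball_mdeg n : {fset midx D} :=
  fset_set [set b : midx D | (mdeg b <= n)%N].

Lemma mem_ball_mdeg n b : (b \in ball_mdeg n) = (mdeg b <= n)%N.
Proof.
rewrite in_fset_set; last exact: finite_mdeg_le.
by apply/idP/idP; rewrite inE.
Qed.

Lemma ball_sum_stable (V : nmodType) n m (f : midx D -> V) : (n <= m)%N ->
  (forall b, (n < mdeg b)%N -> f b = 0) ->
  \sum_(b <- ball_mdeg m) f b = \sum_(b <- ball_mdeg n) f b.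
Proof.
move=> nm f0; apply/esym/big_fset_incl.
  by apply/fsubsetP => b; rewrite !mem_ball_mdeg => /leq_trans; apply.
by move=> b _; rewrite mem_ball_mdeg -ltnNge => /f0.
Qed.

Lemma ball_sum_delta n b (f : midx D -> R[i]) : (mdeg b <= n)%N ->
  (forall c, c != b -> f c = 0) -> \sum_(c <- ball_mdeg n) f c = f b.
Proof.
move=> bn f0; rewrite (big_fsetD1 b) ?mem_ball_mdeg //= big1_fset ?addr0 //.
by move=> c; rewrite !inE => /andP[/f0].
Qed.

Lemma msumE (f : midx D -> R[i]) :
  Defs.msum f = lim ((fun n => \sum_(b <- ball_mdeg n) f b) @ \oo).
Proof.
rewrite /Defs.msum; congr (lim (_ @ \oo)); apply/funext => n.
by rewrite fsbig_finite //; exact: finite_mdeg_le.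
Qed.

Lemma msum_fin n (f : midx D -> R[i]) :
  (forall b, (n < mdeg b)%N -> f b = 0) -> Defs.msum f = \sum_(b <- ball_mdeg n) f b.
Proof.
move=> f0; rewrite msumE; apply: cvgC_lim.
apply: (near_eq_cvgC (F := \oo) (f := fun=> \sum_(b <- ball_mdeg n) f b));
  last exact: cvgC_cst.
by exists n => // m /= nm; rewrite (ball_sum_stable nm).
Qed.

Lemma smulE : @smul R D = @mmul R D.
Proof. by rewrite mmul.unlock. Qed.

Lemma mmul_fin n A B b c :
  (forall d, (n < mdeg d)%N -> A b d * B d c = 0) ->
  mmul A B b c = \sum_(d <- ball_mdeg n) A b d * B d c.
Proof. rewrite -smulE; exact: msum_fin. Qed.

Lemma mmul_delta A B b c d : (forall e, e != d -> A b e * B e c = 0) ->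
  mmul A B b c = A b d * B d c.
Proof.
move=> AB0; rewrite (@mmul_fin (mdeg d)); first exact: ball_sum_delta.
by move=> e de; apply: AB0; apply: contraTneq de => ->; rewrite ltnn.
Qed.

Lemma mmul1x A : mmul sone A = A.
Proof.
apply/funext => b; apply/funext => c; rewrite (@mmul_delta _ _ _ _ b).
  by rewrite /sone eqxx mul1r.
by move=> d; rewrite /sone eq_sym => /negPf ->; rewrite mul0r.
Qed.

Lemma mmulx1 A : mmul A sone = A.
Proof.
apply/funext => b; apply/funext => c; rewrite (@mmul_delta _ _ _ _ c).
  by rewrite /sone eqxx mulr1.
by move=> d; rewrite /sone => /negPf ->; rewrite mulr0.
Qed.

Lemma mmul_Upsilonl (alpha : midx D) A b c :
  mmul (Upsilon alpha) A b c = A (b + alpha) c.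
Proof.
rewrite (@mmul_delta _ _ _ _ (b + alpha)); first by rewrite /Upsilon eqxx mul1r.
by move=> d; rewrite /Upsilon eq_sym => /negPf ->; rewrite mul0r.
Qed.

Lemma UpsilonC (alpha beta : midx D) :
  mmul (Upsilon alpha) (Upsilon beta) =
  mmul (Upsilon beta) (Upsilon alpha) :> smx R D.
Proof.
apply/funext => b; apply/funext => c.
by rewrite !mmul_Upsilonl /Upsilon addrAC.
Qed.

(* The [rfin] matrices form an algebra acting on the left on all matrices; every
   product of the theorem has an [rfin] left factor, so no infinite sum occurs. *)
Definition rfin A := forall k, exists n, forall b c,
  (mdeg b <= k)%N -> (n < mdeg c)%N -> A b c = 0.

(** Needed for products with the full moment matrix on the left, which are finite only through their
    right factor, such as the block upper triangular [V]. *)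
Definition cfin A := forall k, exists n, forall b c,
  (mdeg c <= k)%N -> (n < mdeg b)%N -> A b c = 0.

Definition lower A := forall b c, (mdeg b < mdeg c)%N -> A b c = 0.
Definition slower A := forall b c, (mdeg b <= mdeg c)%N -> A b c = 0.
Definition upper A := forall b c, (mdeg c < mdeg b)%N -> A b c = 0.

Lemma lower_rfin A : lower A -> rfin A.
Proof.
by move=> lA k; exists k => b c bk kc; apply: lA; apply: leq_ltn_trans bk kc.
Qed.

Lemma slower_lower A : slower A -> lower A.
Proof. by move=> lA b c /ltnW; exact: lA. Qed.

Lemma slower_rfin A : slower A -> rfin A.
Proof. by move=> /slower_lower /lower_rfin. Qed.

Lemma upper_cfin A : upper A -> cfin A.
Proof.
by move=> uA k; exists k => b c bk kc; apply: uA; apply: leq_ltn_trans bk kc.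
Qed.

Lemma blower_uni_lower A : blower_uni A -> lower A.
Proof.
move=> lA b c bc; rewrite lA ?(ltnW bc) //.
by case: eqP bc => // ->; rewrite ltnn.
Qed.

Lemma blower_uni_rfin A : blower_uni A -> rfin A.
Proof. by move=> /blower_uni_lower /lower_rfin. Qed.

Lemma bdiag_lower A : bdiag A -> lower A.
Proof. by move=> dA b c bc; apply: dA => e; rewrite e ltnn in bc. Qed.

Lemma bdiag_upper A : bdiag A -> upper A.
Proof. by move=> dA b c bc; apply: dA => e; rewrite e ltnn in bc. Qed.

Lemma blower_uni1 : blower_uni (sone : smx R D).
Proof. by []. Qed.

Lemma mdegD b c : (mdeg (b + c)%R <= mdeg b + mdeg c)%N.
Proof.
rewrite /mdeg -big_split /=; apply: leq_sum => a _.
by rewrite ffunE -lez_nat PoszD !abszE ler_normD.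
Qed.

Lemma Upsilon_rfin (alpha : midx D) : rfin (Upsilon alpha : smx R D).
Proof.
move=> k; exists (k + mdeg alpha)%N => b c bk; rewrite /Upsilon.
case: eqP => // <-; rewrite ltnNge (leq_trans (mdegD _ _)) //.
by rewrite leq_add2r.
Qed.

Lemma supper_upper A : upper (supper A).
Proof. by move=> b c cb; rewrite /supper leqNgt cb. Qed.

Lemma supper_rfin A : rfin A -> rfin (supper A).
Proof.
by move=> rA k; have [n An] := rA k; exists n => b c bk nc; rewrite /supper;
  case: ifP => // _; apply: An.
Qed.

Lemma slower_part A : slower (A - supper A).
Proof. by move=> b c bc; rewrite !fctE /supper bc subrr. Qed.

Lemma supperB A B : supper (A - B) = supper A - supper B.
Proof.
apply/funext => b; apply/funext => c; rewrite !fctE /supper.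
by case: ifP; rewrite ?subrr.
Qed.

Lemma supper_id A : upper A -> supper A = A.
Proof.
move=> uA; apply/funext => b; apply/funext => c; rewrite /supper.
by case: leqP => // /uA.
Qed.

Lemma supper_slower A : slower A -> supper A = 0.
Proof.
move=> lA; apply/funext => b; apply/funext => c; rewrite /supper.
by case: leqP => // /lA.
Qed.

Lemma rfin_mmul A B : rfin A -> rfin B -> rfin (mmul A B).
Proof.
move=> rA rB k; have [n An] := rA k; have [m Bm] := rB n.
exists m => b c bk mc; rewrite (@mmul_fin n) => [|d nd]; last by rewrite An ?mul0r.
rewrite big_seq big1 // => d; rewrite mem_ball_mdeg => dn.
by rewrite (Bm d c) ?mulr0.
Qed.

Lemma rfinD A B : rfin A -> rfin B -> rfin (A + B).
Proof.
move=> rA rB k; have [n An] := rA k; have [m Bm] := rB k.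
exists (maxn n m) => b c bk; rewrite gtn_max => /andP[nc mc].
by rewrite !fctE An // Bm // addr0.
Qed.

Lemma rfinN A : rfin A -> rfin (- A).
Proof.
move=> rA k; have [n An] := rA k.
by exists n => b c bk nc; rewrite !fctE An // oppr0.
Qed.

Lemma rfinB A B : rfin A -> rfin B -> rfin (A - B).
Proof. by move=> rA rB; apply: rfinD => //; exact: rfinN. Qed.

(** Associativity is an exchange of two finite sums. Only the products [B e d * C d c] have to
    vanish for large [d], so that the bound may come from the rows of [B] or from the columns of
    [C]. *)
Lemma mmulA_entry A B C b c n m :
  (forall e, (n < mdeg e)%N -> A b e = 0) ->
  (forall e d, (mdeg e <= n)%N -> (m < mdeg d)%N -> B e d * C d c = 0) ->
  mmul (mmul A B) C b c = mmul A (mmul B C) b c.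
Proof.
move=> An BCm.
have ABE d : mmul A B b d = \sum_(e <- ball_mdeg n) A b e * B e d.
  by apply: mmul_fin => e /An ->; rewrite mul0r.
rewrite (@mmul_fin m) => [|d md]; last first.
  rewrite ABE mulr_suml big_seq big1 // => e; rewrite mem_ball_mdeg => en.
  by rewrite -mulrA BCm // mulr0.
rewrite [RHS](@mmul_fin n) => [|d /An ->]; last by rewrite mul0r.
under eq_bigr do rewrite ABE mulr_suml.
rewrite exchange_big /=; apply: eq_big_seq => e; rewrite mem_ball_mdeg => en.
rewrite (@mmul_fin m) => [|d]; last exact: BCm.
by rewrite mulr_sumr; apply: eq_bigr => d _; rewrite mulrA.
Qed.

Lemma mmulA A B C : rfin A -> rfin B ->
  mmul (mmul A B) C = mmul A (mmul B C).
Proof.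
move=> rA rB; apply/funext => b; apply/funext => c.
have [n An] := rA (mdeg b); have [m Bm] := rB n.
apply: (@mmulA_entry _ _ _ _ _ n m) => [e|e d en md]; first exact: An.
by rewrite Bm // mul0r.
Qed.

Lemma mmulA_rc A B C : rfin A -> cfin C ->
  mmul (mmul A B) C = mmul A (mmul B C).
Proof.
move=> rA rC; apply/funext => b; apply/funext => c.
have [n An] := rA (mdeg b); have [m Cm] := rC (mdeg c).
apply: (@mmulA_entry _ _ _ _ _ n m) => [e|e d en md]; first exact: An.
by rewrite Cm // mulr0.
Qed.

Lemma mmulDl A B C : rfin A -> rfin B ->
  mmul (A + B) C = mmul A C + mmul B C.
Proof.
move=> rA rB; apply/funext => b; apply/funext => c; rewrite !fctE.
have [n An] := rA (mdeg b); have [m Bm] := rB (mdeg b).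
have An' d : (maxn n m < mdeg d)%N -> A b d = 0.
  by rewrite gtn_max => /andP[nd _]; exact: An.
have Bm' d : (maxn n m < mdeg d)%N -> B b d = 0.
  by rewrite gtn_max => /andP[_ md]; exact: Bm.
rewrite !(@mmul_fin (maxn n m)) => [|d /Bm' -> |d /An' -> |d md];
  rewrite ?mul0r // -?big_split /=.
  by apply: eq_bigr => d _; rewrite !fctE mulrDl.
by rewrite !fctE Bm' // An' // addr0 mul0r.
Qed.

Lemma mmulDr A B C : rfin A -> mmul A (B + C) = mmul A B + mmul A C.
Proof.
move=> rA; apply/funext => b; apply/funext => c; rewrite !fctE.
have [n An] := rA (mdeg b).
have An' d : (n < mdeg d)%N -> A b d = 0 by exact: An.
rewrite !(@mmul_fin n) => [|d /An' -> |d /An' -> |d /An' ->];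
  rewrite ?mul0r // -big_split /=.
by apply: eq_bigr => d _; rewrite !fctE mulrDr.
Qed.

Lemma mmulNl A B : rfin A -> mmul (- A) B = - mmul A B.
Proof.
move=> rA; apply/funext => b; apply/funext => c; rewrite !fctE.
have [n An] := rA (mdeg b).
have An' d : (n < mdeg d)%N -> A b d = 0 by exact: An.
rewrite !(@mmul_fin n) => [|d /An' -> |d /An' Abd];
  rewrite ?fctE ?Abd ?oppr0 ?mul0r // -sumrN.
by apply: eq_bigr => d _; rewrite -mulNr.
Qed.

Lemma mmulNr A B : rfin A -> mmul A (- B) = - mmul A B.
Proof.
move=> rA; apply/funext => b; apply/funext => c; rewrite !fctE.
have [n An] := rA (mdeg b).
have An' d : (n < mdeg d)%N -> A b d = 0 by exact: An.
rewrite !(@mmul_fin n) => [|d /An' -> |d /An' ->];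
  rewrite ?mul0r // -sumrN.
by apply: eq_bigr => d _; rewrite !fctE mulrN.
Qed.

Lemma mmulBl A B C : rfin A -> rfin B ->
  mmul (A - B) C = mmul A C - mmul B C.
Proof. by move=> rA rB; rewrite mmulDl ?mmulNl //; exact: rfinN. Qed.

Lemma mmulBr A B C : rfin A -> mmul A (B - C) = mmul A B - mmul A C.
Proof. by move=> rA; rewrite mmulDr ?mmulNr. Qed.

Lemma lower_mmul A B : lower A -> lower B -> lower (mmul A B).
Proof.
move=> lA lB b c bc; rewrite (@mmul_fin (mdeg b)) => [|d bd].
  rewrite big_seq big1 // => d; rewrite mem_ball_mdeg => db.
  by rewrite (lB d c) ?mulr0 // (leq_ltn_trans db).
by rewrite lA // mul0r.
Qed.

Lemma slower_mmul A B : slower A -> lower B -> slower (mmul A B).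
Proof.
move=> lA lB b c bc; rewrite (@mmul_fin (mdeg b)) => [|d /ltnW bd].
  rewrite big_seq big1 // => d; rewrite mem_ball_mdeg => db.
  have [bd|db'] := leqP (mdeg b) (mdeg d); first by rewrite lA // mul0r.
  by rewrite (lB d c) ?mulr0 // (leq_trans db').
by rewrite lA // mul0r.
Qed.

Lemma upper_mmul A B : rfin A -> upper A -> upper B -> upper (mmul A B).
Proof.
move=> rA uA uB b c cb; have [n An] := rA (mdeg b).
rewrite (@mmul_fin n) => [|d nd]; last by rewrite An // mul0r.
rewrite big1 // => d _.
have [bd|db] := leqP (mdeg b) (mdeg d); last by rewrite uA // mul0r.
by rewrite (uB d c) ?mulr0 // (leq_trans cb).
Qed.

Lemma sadjK A : sadj (sadj A) = A.
Proof. by apply/funext => b; apply/funext => c; rewrite /sadj conjcK. Qed.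

Lemma sadj_rfin A : cfin (sadj A) <-> rfin A.
Proof.
split=> fA k; have [n An] := fA k; exists n => b c bk nc.
  by have /eqP := An c b bk nc; rewrite /sadj conjc_eq0 => /eqP.
by rewrite /sadj An // conjc0.
Qed.

Lemma sadj_mmul A B : rfin A -> sadj (mmul A B) = mmul (sadj B) (sadj A).
Proof.
move=> rA; apply/funext => b; apply/funext => c; have [n An] := rA (mdeg c).
have An' d : (n < mdeg d)%N -> A c d = 0 by exact: An.
rewrite /sadj !(@mmul_fin n) => [|d /An' ->|d /An' ->]; rewrite ?mul0r //.
  by rewrite rmorph_sum; apply: eq_bigr => d _; rewrite rmorphM mulrC.
by rewrite rmorph0 mulr0.
Qed.

Lemma sadj1 : sadj sone = sone :> smx R D.
Proof.
by apply/funext => b; apply/funext => c; rewrite /sadj /sone eq_sym conjc_nat.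
Qed.

(** The adjoint exchanges row- and column-finite matrices and reverses products, which reduces this
    to [mmulA]. *)
Lemma mmulA_cc A B C : cfin B -> cfin C ->
  mmul (mmul A B) C = mmul A (mmul B C).
Proof.
rewrite -(sadjK A) -(sadjK B) -(sadjK C).
move: (sadj A) (sadj B) (sadj C) => {}A {}B {}C /sadj_rfin rB /sadj_rfin rC.
rewrite -(sadj_mmul A rB) -(sadj_mmul B rC) -sadj_mmul // -sadj_mmul ?mmulA //.
exact: rfin_mmul.
Qed.

End SemiInfinite.

(** * Triangular inverses and the Gauss-Borel factorization *)

Section Factorization.
Context {R : realType} {D : nat}.
Local Open Scope complex_scope.
Implicit Types (A B S T M H V : smx R D) (b c d : midx D) (k n : nat).

(* Partial Neumann sums of the inverse of [1 - N]. *)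
Let neumann (N : smx R D) n : smx R D :=
  iter n (fun X => sone + mmul N X) 0.

Lemma slower_mmul_entry N X Y b c : slower N ->
  (forall d, (mdeg d < mdeg b)%N -> X d c = Y d c) ->
  mmul N X b c = mmul N Y b c :> R[i].
Proof.
move=> lN XY; rewrite !(@mmul_fin _ _ (mdeg b)) => [|d /ltnW bd|d /ltnW bd];
  rewrite ?lN ?mul0r //.
apply: eq_bigr => d _; have [bd|db] := leqP (mdeg b) (mdeg d).
  by rewrite lN // !mul0r.
by rewrite XY.
Qed.

(** Row [b] of [mmul N X] depends only on the rows of [X] of smaller degree. Hence row [b] of the
    Neumann sums is stationary from index [(mdeg b).+1] on, and the stationary rows form the fixed
    point. *)
Lemma slower_fixpoint N : slower N -> exists T, T = sone + mmul N T.
Proof.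
move=> lN; pose U := neumann N.
have US n b c : (mdeg b < n)%N -> U n.+1 b c = U n b c.
  elim: n b c => // n IH b c bn; rewrite /U /neumann !iterS !fctE.
  congr (_ + _); apply: slower_mmul_entry => // d db.
  by apply: IH; apply: leq_trans db bn.
have Ustab n b c : (mdeg b < n)%N -> U n b c = U (mdeg b).+1 b c.
  elim: n => // n IH; rewrite ltnS leq_eqVlt => /orP[/eqP -> //|bn].
  by rewrite US // IH.
exists (fun b c => U (mdeg b).+1 b c).
apply/funext => b; apply/funext => c; rewrite {1}/U /neumann iterS !fctE.
congr (_ + _); apply: slower_mmul_entry => // d db.
exact: (Ustab (mdeg b)).
Qed.

Lemma blower_uni_rinv S : blower_uni S ->
  exists2 T, blower_uni T & mmul S T = sone.
Proof.
move=> uS; pose N := sone - S.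
have lN : slower N.
  by move=> b c bc; rewrite /N !fctE uS // /sone subrr.
have [T TE] := slower_fixpoint lN; exists T; last first.
  have -> : S = sone - N by rewrite /N opprB addrC subrK.
  rewrite mmulBl ?mmul1x; last exact: slower_rfin.
    by rewrite [X in X - _]TE addrK.
  exact/blower_uni_rfin/blower_uni1.
suff TP k b c : (mdeg b < k)%N -> (mdeg b <= mdeg c)%N -> T b c = (b == c)%:R.
  by move=> b c; exact: (TP (mdeg b).+1).
elim: k b c => // k IH b c bk bc; rewrite TE !fctE /sone.
(* A row [d] of degree below [mdeg b <= mdeg c] has [T d c = 0] by induction, so [T] may be replaced
   by [0]. *)
rewrite (@slower_mmul_entry _ _ 0) // => [|d db].
  rewrite (@mmul_fin _ _ 0) ?big1 ?addr0 // => d _; exact: mulr0.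
rewrite IH ?(leq_trans db) ?(leq_trans (ltnW db)) //.
case: eqP => // dc; by rewrite dc ltnNge bc in db.
Qed.

(** The right inverse [T] of [S] has itself a right inverse [S'], and associativity gives [S = S'];
    so [T] is two-sided and the choice made by [sinv] is not its default value. *)
Lemma sinvP S : blower_uni S ->
  [/\ blower_uni (sinv S), mmul S (sinv S) = sone & mmul (sinv S) S = sone].
Proof.
move=> uS; rewrite /sinv smulE; apply: (xgetPex sone (P := [set B | [/\ blower_uni B, _ & _]])).
have [T uT ST] := blower_uni_rinv uS; have [S' uS' TS'] := blower_uni_rinv uT.
exists T; split=> //; suff -> : S = S' by [].
rewrite -[LHS]mmulx1 -TS' -mmulA; try exact: blower_uni_rfin.
by rewrite ST mmul1x.
Qed.

Lemma sinv_rfin A : blower_uni A -> rfin (sinv A).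
Proof. by move=> uA; have [/blower_uni_rfin] := sinvP uA. Qed.

Lemma sinv_lower A : blower_uni A -> lower (sinv A).
Proof. by move=> uA; have [/blower_uni_lower] := sinvP uA. Qed.

Lemma mmulVS A B : blower_uni A -> mmul (sinv A) (mmul A B) = B .
Proof.
move=> uA; have [_ _ TA] := sinvP uA.
by rewrite -(mmulA _ (sinv_rfin uA) (blower_uni_rfin uA)) TA mmul1x.
Qed.

Lemma mmulSV A B : blower_uni A -> mmul A (mmul (sinv A) B) = B .
Proof.
move=> uA; have [_ AT _] := sinvP uA.
by rewrite -(mmulA _ (blower_uni_rfin uA) (sinv_rfin uA)) AT mmul1x.
Qed.

Lemma finite_mdeg_eq k : finite_set [set d : midx D | mdeg d = k].
Proof.
by apply: sub_finite_set (@finite_mdeg_le D k) => d /= ->.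
Qed.

Lemma level_sumE (V : nmodType) k (f : midx D -> V) :
  (forall d, mdeg d <> k -> f d = 0) ->
  \sum_(d <- ball_mdeg k) f d = \sum_(d \in [set d | mdeg d = k]) f d.
Proof.
move=> f0; rewrite fsbig_finite; last exact: finite_mdeg_eq.
apply/esym/big_fset_incl.
  apply/fsubsetP => d; rewrite mem_ball_mdeg in_fset_set; last exact: finite_mdeg_eq.
  by rewrite inE /= => ->.
move=> d _; rewrite in_fset_set; last exact: finite_mdeg_eq.
by move=> dk; apply: f0 => e; move/negP: dk; apply; rewrite inE.
Qed.

Lemma block_unit_rinv H : bdiag H -> (forall k, block_unit H k) ->
  exists2 K, bdiag K & mmul H K = sone.
Proof.
move=> dH /choice[B HB].
exists (fun b c => if mdeg b == mdeg c then B (mdeg b) b c else 0).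
  by move=> b c /eqP /negPf ->.
apply/funext => b; apply/funext => c.
rewrite (@mmul_fin _ _ (mdeg b)) => [|d bd]; last first.
  by rewrite dH ?mul0r // => e; rewrite e ltnn in bd.
rewrite level_sumE => [|d db]; last by rewrite dH ?mul0r // => /esym.
have [bc|bc] := eqVneq (mdeg b) (mdeg c); last first.
  rewrite /sone; case: eqP => [e|_]; first by rewrite e eqxx in bc.
  by rewrite fsbig1 // => d /= ->; rewrite (negPf bc) mulr0.
rewrite -[RHS]((HB (mdeg b)).1 b c) //; apply: eq_fsbigr => d.
by rewrite inE /= => ->; rewrite bc eqxx.
Qed.

Lemma block_inv_sadj A B k : block_inv A B k -> block_inv (sadj B) (sadj A) k.
Proof.
move=> AB b c bk ck; rewrite eq_sym -(conjc_nat _ (c == b)) -(AB c b ck bk).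
rewrite !fsbig_finite ?rmorph_sum /=; try exact: finite_mdeg_eq.
by apply: eq_bigr => d _; rewrite rmorphM mulrC.
Qed.

Lemma gauss_borel_sadj M S H hS :
  gauss_borel M S H hS -> gauss_borel (sadj M) hS (sadj H) S.
Proof.
rewrite /gauss_borel !smulE; case=> uS uhS dH uH ->; split=> //.
- by move=> b c bc; rewrite /sadj dH ?conjc0 // => /esym.
- move=> k; have [B [HB BH]] := uH k.
  by exists (sadj B); split; apply: block_inv_sadj.
have [uT _ _] := sinvP uS; have [uhT _ _] := sinvP uhS.
have rT := blower_uni_rfin uT; have rhT := blower_uni_rfin uhT.
have rH := lower_rfin (bdiag_lower dH).
have dH' : bdiag (sadj H).
  by move=> b c bc; rewrite /sadj dH ?conjc0 // => /esym.
rewrite sadj_mmul; last exact: rfin_mmul.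
rewrite sadjK sadj_mmul // mmulA //.
exact: lower_rfin (bdiag_lower dH').
Qed.

Lemma sadj_upper A : lower A -> upper (sadj A).
Proof. by move=> lA b c cb; rewrite /sadj lA ?conjc0. Qed.

Lemma gauss_borel_lsolve M S H hS : gauss_borel M S H hS ->
  mmul S M = mmul H (sadj (sinv hS)).
Proof.
rewrite /gauss_borel !smulE; case=> uS uhS dH _ ->; have [uT ST _] := sinvP uS.
have rT := blower_uni_rfin uT; have rH := lower_rfin (bdiag_lower dH).
rewrite (mmulA _ rT rH) -mmulA //; last exact: blower_uni_rfin.
by rewrite ST mmul1x.
Qed.

Lemma gauss_borel_upper M S H hS : gauss_borel M S H hS -> upper (mmul S M).
Proof.
move=> gb; rewrite (gauss_borel_lsolve gb); case: gb => _ uhS dH _ _.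
have [uhT _ _] := sinvP uhS.
apply: upper_mmul (bdiag_upper dH) _; first exact: lower_rfin (bdiag_lower dH).
exact/sadj_upper/blower_uni_lower.
Qed.

(** As [S M = H (sadj (sinv hS))], the right inverse is [sadj hS] times the blockwise inverse [K] of
    [H]. *)
Lemma gauss_borel_rinv M S H hS : gauss_borel M S H hS ->
  exists2 V, upper V & mmul (mmul S M) V = sone.
Proof.
move=> gb; rewrite (gauss_borel_lsolve gb); case: gb => _ uhS dH uH _.
have [K dK HK] := block_unit_rinv dH uH.
have [uhT hST _] := sinvP uhS.
have rhS := blower_uni_rfin uhS; have rhT := blower_uni_rfin uhT.
have rH := lower_rfin (bdiag_lower dH); have uK := bdiag_upper dK.
have chS : cfin (sadj hS) by apply/sadj_rfin.
(* [upper_mmul] does not apply, since [sadj hS] need not be row-finite; the sum is bounded by column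
   [c] of [K]. *)
have uV : upper (mmul (sadj hS) K).
  move=> b c cb; rewrite (@mmul_fin _ _ (mdeg c)) => [|d cd]; last first.
    by rewrite uK // mulr0.
  rewrite big_seq big1 // => d; rewrite mem_ball_mdeg => dc.
  by rewrite (sadj_upper (blower_uni_lower uhS)) ?mul0r ?(leq_ltn_trans dc).
exists (mmul (sadj hS) K) => //.
rewrite (mmulA_rc _ rH (upper_cfin uV)).
rewrite -(mmulA_cc _ chS (upper_cfin uK)) -sadj_mmul //.
by rewrite hST sadj1 mmul1x.
Qed.

End Factorization.

(** * Derivatives of the factors *)

Section Scaling.
Context {R : realType} {D : nat}.
Implicit Types (A B C V : smx R D) (b c d : midx D) (a : R[i]).

Definition sscale a A : smx R D := fun b c => a * A b c.

Lemma mmulZl a A B : rfin A -> mmul (sscale a A) B = sscale a (mmul A B).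
Proof.
move=> rA; apply/funext => b; apply/funext => c; have [n An] := rA (mdeg b).
have An' d : (n < mdeg d)%N -> A b d = 0 by exact: An.
rewrite /sscale !(@mmul_fin _ _ n) => [|d /An' ->|d /An' ->]; last 2 first.
  by rewrite mul0r.
  by rewrite mulr0 mul0r.
by rewrite mulr_sumr; apply: eq_bigr => d _; rewrite mulrA.
Qed.

Lemma mmulZr a A B : rfin A -> mmul A (sscale a B) = sscale a (mmul A B).
Proof.
move=> rA; apply/funext => b; apply/funext => c; have [n An] := rA (mdeg b).
have An' d : (n < mdeg d)%N -> A b d = 0 by exact: An.
rewrite /sscale !(@mmul_fin _ _ n) => [|d /An' ->|d /An' ->];
  rewrite ?mul0r //.
by rewrite mulr_sumr; apply: eq_bigr => d _; rewrite mulrCA.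
Qed.

Lemma mmulZl_c a A V : cfin V -> mmul (sscale a A) V = sscale a (mmul A V).
Proof.
move=> cV; apply/funext => b; apply/funext => c; have [n Vn] := cV (mdeg c).
have Vn' d : (n < mdeg d)%N -> V d c = 0 by move=> nd; exact: Vn nd.
rewrite /sscale !(@mmul_fin _ _ n) => [|d /Vn' ->|d /Vn' ->];
  rewrite ?mulr0 //.
by rewrite mulr_sumr; apply: eq_bigr => d _; rewrite mulrA.
Qed.

Lemma mmulBl_c A B V : cfin V -> mmul (A - B) V = mmul A V - mmul B V.
Proof.
move=> cV; apply/funext => b; apply/funext => c; have [n Vn] := cV (mdeg c).
have Vn' d : (n < mdeg d)%N -> V d c = 0 by move=> nd; exact: Vn nd.
rewrite !fctE !(@mmul_fin _ _ n) => [|d /Vn' ->|d /Vn' ->|d /Vn' ->];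
  rewrite ?mulr0 // -sumrB.
by apply: eq_bigr => d _; rewrite -mulrBl.
Qed.

End Scaling.

(** * Commutators and the algebra of zero curvature *)

Section Commutators.
Context {R : realType} {D : nat}.
Implicit Types (A B L J S T Y Z W : smx R D).

Lemma scommE A B : scomm A B = mmul A B - mmul B A.
Proof. by rewrite -smulE. Qed.

Lemma scomm_upper A B :
  rfin A -> rfin B -> upper A -> upper B -> upper (scomm A B).
Proof.
move=> rA rB uA uB b c cb; rewrite scommE !fctE.
by rewrite (upper_mmul rA uA uB) // (upper_mmul rB uB uA) // subrr.
Qed.

Lemma scomm_slower A B : slower A -> slower B -> slower (scomm A B).
Proof.
move=> lA lB b c bc; rewrite scommE !fctE.
rewrite (slower_mmul lA (slower_lower lB)) //.
by rewrite (slower_mmul lB (slower_lower lA)) // subrr.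
Qed.

(** Expanding [[A + L, B + M] = 0] gives [[B, L] - [A, M] = [A, B] + [L, M]], to which [[B, A] -
    [A, B]] adds [- 2 [A, B]]. *)
Lemma scomm_decomposition A L B M : rfin A -> rfin L -> rfin B -> rfin M ->
  mmul (A + L) (B + M) = mmul (B + M) (A + L) ->
  scomm B (A + L) - scomm A (B + M) = scomm L M - scomm A B.
Proof.
move=> rA rL rB rM; rewrite !scommE !(mmulDl _ rA rL) !(mmulDl _ rB rM).
rewrite !(mmulDr _ _ rA) !(mmulDr _ _ rB) !(mmulDr _ _ rL) !(mmulDr _ _ rM).
move=> E; apply/funext => b; apply/funext => c.
move: (congr1 (fun X : smx R D => X b c) E); rewrite !fctE /=.
move: (mmul A B b c) (mmul B A b c) (mmul L M b c) (mmul M L b c) => x1 x2 x3 x4.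
move: (mmul A M b c) (mmul M A b c) (mmul L B b c) (mmul B L b c) => x5 x6 x7 x8.
move=> {}E; have -> : x3 = x1 + x5 + (x7 + x3) - x1 - x5 - x7 by ring.
by rewrite E; ring.
Qed.

Lemma similar_comm S T Y Y' : rfin S -> rfin T -> rfin Y -> rfin Y' ->
  mmul T S = sone -> mmul Y Y' = mmul Y' Y ->
  mmul (mmul (mmul S Y) T) (mmul (mmul S Y') T) =
  mmul (mmul (mmul S Y') T) (mmul (mmul S Y) T).
Proof.
move=> rS rT rY rY' TS YC.
suff E Z W : rfin Z -> rfin W ->
    mmul (mmul (mmul S Z) T) (mmul (mmul S W) T) = mmul (mmul S (mmul Z W)) T.
  by rewrite !E // YC.
move=> rZ rW; have rSZ := rfin_mmul rS rZ; have rSW := rfin_mmul rS rW.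
rewrite (mmulA _ rSZ rT) -(mmulA _ rT rSW) -(mmulA _ rT rS) TS mmul1x.
by rewrite -(mmulA _ rSZ rW) (mmulA _ rS rZ).
Qed.

(* Writing [J = B + L], [J' = B' + L'] with [L], [L'] strictly lower, the
   relation [[J, J'] = 0] reads [[B', J] - [B, J'] = [L, L'] - [B, B']]. *)
Lemma zero_curvature J J' : rfin J -> rfin J' -> mmul J J' = mmul J' J ->
  supper (scomm (supper J') J) - supper (scomm (supper J) J')
    + scomm (supper J) (supper J') = 0.
Proof.
move=> rJ rJ' JC.
have lL : slower (J - supper J) by exact: slower_part.
have lL' : slower (J' - supper J') by exact: slower_part.
have rB := supper_rfin rJ; have rB' := supper_rfin rJ'.
have JE : supper J + (J - supper J) = J by rewrite addrC subrK.
have JE' : supper J' + (J' - supper J') = J' by rewrite addrC subrK.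
have := scomm_decomposition rB (slower_rfin lL) rB' (slower_rfin lL').
rewrite JE JE' => /(_ JC) E.
(* [[L, L']] is strictly lower and disappears; [[B, B']] is upper and stays. *)
rewrite -supperB E supperB (supper_slower (scomm_slower lL lL')).
have uB := scomm_upper rB rB' (@supper_upper _ _ _) (@supper_upper _ _ _).
by rewrite (supper_id uB) sub0r addNr.
Qed.

End Commutators.

(** * Finite linear systems whose matrix tends to the identity *)

Section RowSystems.
Context {R : realType} {I : Type} {F : set_system I} {FF : Filter F}.

Lemma near_all_seq (J : eqType) (r : seq J) (P : J -> I -> Prop) :
  (forall c, c \in r -> \forall h \near F, P c h) ->
  \forall h \near F, forall c, c \in r -> P c h.
Proof.
elim: r => [|j s IH] H; first exact: filterE.
have Hj := H j (mem_head _ _).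
have Hs : \forall h \near F, forall c, c \in s -> P c h.
  by apply: IH => c cs; apply: H; rewrite inE cs orbT.
apply: filterS2 Hj Hs => h Pj Ps c; rewrite inE => /orP[/eqP -> //|].
exact: Ps.
Qed.

(* The defect [L h - 1] is eventually at most [1/2], which bounds [y]. *)
Lemma cvg_row_system (J : choiceType) (r : seq J) (y p : I -> J -> R[i])
    (L : I -> J -> J -> R[i]) (p0 : J -> R[i]) : uniq r ->
  (forall c, c \in r -> \forall h \near F, \sum_(d <- r) y h d * L h d c = p h c) ->
  (forall d c, L h d c @[h --> F] --> ((d == c)%:R : R[i])) ->
  (forall c, p h c @[h --> F] --> p0 c) ->
  forall c, c \in r -> y h c @[h --> F] --> p0 c.
Proof.
move=> ur yL cL cp.
pose E h d c := L h d c - (d == c)%:R.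
have cE d c : E h d c @[h --> F] --> (0 : R[i]).
  have H := cvgC_sub (cL d c) (@cvgC_cst _ _ F _ (d == c)%:R).
  by rewrite subrr in H; exact: H.
have yE c : c \in r ->
    \forall h \near F, y h c = p h c - \sum_(d <- r) y h d * E h d c.
  move=> cr; apply: filterS (yL c cr) => h <-.
  rewrite -sumrB (eq_bigr (fun d => y h d * (d == c)%:R)) => [|d _]; last first.
    by rewrite -mulrBr /E opprB addrC subrK.
  rewrite (bigD1_seq c) //= eqxx mulr1 big1 ?addr0 // => d /negPf ->.
  by rewrite mulr0.
have yE' := near_all_seq yE.
(* The successor keeps [n] positive for empty [r]; with [e = 1 / (2 n)] the defects in a row add up
   to at most [1 / 2]. *)
pose n : R := (size r).+1%:R.
have n0 : 0 < n by rewrite ltr0n.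
pose e : R := (2 * n)^-1.
have e0 : 0 < e by rewrite invr_gt0 mulr_gt0.
have Ee : \forall h \near F, forall d, d \in r -> forall c, c \in r ->
    norm1 (E h d c) < e.
  apply: near_all_seq => d _; apply: near_all_seq => c _.
  by have /cvg_complexP/(_ e e0) := cE d c; apply: filterS => h; rewrite subr0.
pose K : R := \sum_(c <- r) (norm1 (p0 c) + 1).
have pK : \forall h \near F, forall c, c \in r -> norm1 (p h c) <= norm1 (p0 c) + 1.
  apply: near_all_seq => c _; have /cvg_complexP/(_ 1 ltr01) := cp c.
  apply: filterS => h /ltW ph; rewrite -[p h c](subrK (p0 c)) addrC.
  by apply: le_trans (norm1D _ _) _; rewrite lerD2l.
have yK : \forall h \near F, forall d, d \in r -> norm1 (y h d) <= 2 * K.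
  apply: filterS3 yE' Ee pK => h yh Eh ph.
  (* Summing the equations over [c] gives [s <= K + s / 2], hence [s <= 2 K]. *)
  pose s := \sum_(c <- r) norm1 (y h c).
  have s0 : 0 <= s by apply: sumr_ge0 => c _; exact: norm1_ge0.
  have sK : s <= K + (e * s) *+ size r.
    have -> : (e * s) *+ size r = \sum_(c <- r) e * s.
      by rewrite big_const_seq count_predT iter_addr_0.
    rewrite /K -big_split /= /s big_seq [leRHS]big_seq.
    apply: ler_sum => c cr; rewrite yh //.
    apply: le_trans (norm1D _ _) _; rewrite norm1N; apply: lerD; first exact: ph.
    apply: le_trans (norm1_sum _ _ _) _; rewrite mulr_sumr big_seq.
    apply: ler_sum => d dr; apply: le_trans (norm1M _ _) _; rewrite mulrC.
    by apply: ler_wpM2r; [exact: norm1_ge0|apply: ltW; exact: Eh].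
  have s2 : (e * s) *+ size r <= s / 2.
    have en : s / 2 = e * s * n by rewrite /e; field; rewrite gt_eqF.
    rewrite en -mulr_natr ler_wpM2l ?mulr_ge0 ?(ltW e0) //.
    by rewrite /n ler_nat.
  have sK2 : s <= 2 * K by lra.
  move=> d dr; apply: le_trans sK2; rewrite /s (big_rem d) //= lerDl.
  by apply: sumr_ge0 => c _; exact: norm1_ge0.
move=> c cr; rewrite -[p0 c]subr0.
(* The factors [y h d] are cut off outside [r]: [cvgC_sum] asks for every index, while [y] is
   bounded only on [r]. *)
apply: (near_eq_cvgC (f := fun h => p h c - \sum_(d <- r)
    (if d \in r then y h d else 0) * E h d c)).
  apply: filterS (yE c cr) => h ->; congr (_ - _).
  by apply: eq_big_seq => d ->.
apply: cvgC_sub; first exact: cp.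
apply: (cvgC_eq (z := \sum_(d <- r) 0)); first exact: big1_eq.
apply: (cvgC_sum (f := fun d h => (if d \in r then y h d else 0) * E h d c)
  (z := fun=> 0)) => d.
case: (boolP (d \in r)) => dr; last first.
  by apply: (near_eq_cvgC (f := fun=> 0)); [apply: filterE => h; rewrite mul0r|exact: cvgC_cst].
apply: (cvgC_bounded_mul0 (C := 2 * K)); last exact: cE.
by apply: filterS yK => h; exact.
Qed.

End RowSystems.

(** * Difference quotients of matrix functions *)

Section DifferenceQuotients.
Context {R : realType} {D : nat}.
Context {I : Type} {F : set_system I} {FF : Filter F}.
Variable q : I -> R[i].
Hypothesis q0 : q @ F --> (0 : R[i]).
Hypothesis qN0 : \forall h \near F, q h != 0.
Implicit Types (b c d : midx D).

Lemma lower_mmulE (A B : smx R D) b c : lower A ->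
  mmul A B b c = \sum_(d <- ball_mdeg (mdeg b)) A b d * B d c.
Proof. by move=> lA; apply: mmul_fin => d bd; rewrite lA ?mul0r. Qed.

(** The denominator [q h] is kept apart from the parameter [h], so that [q h = h] and
    [q h = conjc h] are covered at once. *)
Definition is_dq (A : I -> smx R D) (A0 L : smx R D) : Prop :=
  forall b c, (A h b c - A0 b c) / q h @[h --> F] --> L b c.

Lemma is_dq_cvg (A : I -> smx R D) (A0 L : smx R D) b c : is_dq A A0 L -> A h b c @[h --> F] --> A0 b c.
Proof.
move=> /(_ b c) dA; rewrite -[A0 b c]add0r.
apply: (near_eq_cvgC (f := fun h => q h * ((A h b c - A0 b c) / q h) + A0 b c)).
  by apply: filterS qN0 => h qh; rewrite mulrC divfK // subrK.
apply: cvgC_add; last exact: cvgC_cst.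
have H := cvgC_mul q0 dA; rewrite mul0r in H; exact: H.
Qed.

(** Block lower triangularity confines the sum for row [b] to one ball, the same for all [h], so the
    limit is taken termwise; row-finiteness of each [A h] would not give a common bound. *)
Lemma is_dq_mmul (A X : I -> smx R D) (A0 A' X0 X' : smx R D) :
  (\forall h \near F, lower (A h)) -> lower A0 -> lower A' ->
  is_dq A A0 A' -> is_dq X X0 X' ->
  is_dq (fun h => mmul (A h) (X h)) (mmul A0 X0) (mmul A' X0 + mmul A0 X').
Proof.
move=> lA lA0 lA' dA dX b c.
have E : \sum_(d <- ball_mdeg (mdeg b)) (A' b d * X0 d c + A0 b d * X' d c) =
    mmul A' X0 b c + mmul A0 X' b c.
  by rewrite (lower_mmulE _ _ _ lA') (lower_mmulE _ _ _ lA0) big_split.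
apply: cvgC_eq E _.
apply: (near_eq_cvgC (f := fun h => \sum_(d <- ball_mdeg (mdeg b))
    ((A h b d - A0 b d) / q h * X h d c + A0 b d * ((X h d c - X0 d c) / q h)))).
  apply: filterS lA => h lAh.
  rewrite (lower_mmulE _ _ _ lAh) (lower_mmulE _ _ _ lA0).
  rewrite -sumrB mulr_suml; apply: eq_bigr => d _.
  by rewrite mulrAC mulrA -mulrDl mulrBl mulrBr addrA subrK.
apply: cvgC_sum => d; apply: cvgC_add; apply: cvgC_mul.
- exact: dA.
- exact: is_dq_cvg dX.
- exact: cvgC_cst.
- exact: dX.
Qed.

Lemma is_dq_supper (A : I -> smx R D) (A0 L : smx R D) : is_dq A A0 L ->
  is_dq (fun h => supper (A h)) (supper A0) (supper L).
Proof.
move=> dA b c; rewrite /supper; case: ifP => _; first exact: dA.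
apply: (near_eq_cvgC (f := fun=> 0)); last exact: cvgC_cst.
by apply: filterE => h; rewrite subrr mul0r.
Qed.

Lemma is_dq_Upsilon (A : I -> smx R D) (A0 L : smx R D) (alpha : midx D) : is_dq A A0 L ->
  is_dq (fun h => mmul (Upsilon alpha) (A h)) (mmul (Upsilon alpha) A0)
    (mmul (Upsilon alpha) L).
Proof.
move=> dA b c; rewrite !mmul_Upsilonl.
apply: (near_eq_cvgC (f := fun h => (A h (b + alpha) c - A0 (b + alpha) c) / q h)).
  by apply: filterE => h; rewrite mmul_Upsilonl.
exact: dA.
Qed.

Lemma blower_uni_mmulE (S X : smx R D) b c : blower_uni S ->
  mmul S X b c = X b c + \sum_(d <- ball_mdeg (mdeg b))
    (if (mdeg d < mdeg b)%N then S b d * X d c else 0).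
Proof.
move=> uS; pose N := S - sone.
have lN : slower N by move=> e d ed; rewrite /N !fctE uS // /sone subrr.
have r1 := blower_uni_rfin (@blower_uni1 R D).
have SE : S = N + sone by rewrite /N subrK.
rewrite {1}SE (mmulDl _ (slower_rfin lN) r1) mmul1x.
rewrite -[LHS]/(mmul N X b c + X b c) addrC; congr (_ + _).
rewrite (lower_mmulE _ _ _ (slower_lower lN)).
apply: eq_bigr => d _; case: ltnP => [db|bd]; last by rewrite lN ?mul0r.
rewrite SE !fctE /sone; case: eqP => [e|_]; last by rewrite addr0.
by rewrite e ltnn in db.
Qed.

(** Forward substitution: row [b] of [X h] is row [b] of [Y h] minus a finite combination of rows of
    smaller degree, which converge by induction. *)
Lemma cvg_lsolve (S X Y : I -> smx R D) (S0 X0 : smx R D) :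
  (\forall h \near F, blower_uni (S h)) -> blower_uni S0 ->
  (forall b c, S h b c @[h --> F] --> S0 b c) ->
  (\forall h \near F, mmul (S h) (X h) = Y h) ->
  (forall b c, Y h b c @[h --> F] --> mmul S0 X0 b c) ->
  forall b c, X h b c @[h --> F] --> X0 b c.
Proof.
move=> uS uS0 cS SXY cY b.
suff IH k a : (mdeg a < k)%N -> forall c, X h a c @[h --> F] --> X0 a c.
  exact: (IH (mdeg b).+1).
elim: k a => [a a0|k IH a ak c]; first by exfalso; move: a0; rewrite ltn0.
pose T (A B : smx R D) : R[i] := \sum_(d <- ball_mdeg (mdeg a))
    (if (mdeg d < mdeg a)%N then A a d * B d c else 0).
have -> : X0 a c = mmul S0 X0 a c - T S0 X0.
  by rewrite (blower_uni_mmulE _ _ _ uS0) addrK.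
apply: (near_eq_cvgC (f := fun h => Y h a c - T (S h) (X h))).
  by apply: filterS2 uS SXY => h uSh <-; rewrite (blower_uni_mmulE _ _ _ uSh) addrK.
apply: cvgC_sub; first exact: cY.
apply: cvgC_sum => d; case: ltnP => [da|_]; last exact: cvgC_cst.
by apply: cvgC_mul; [exact: cS|apply: IH; apply: leq_trans da ak].
Qed.

(** Entry [b, c] involves finitely many entries of [X h], the same ones for all [h]. *)
Lemma cvg_mmul_lu (A V : smx R D) (X : I -> smx R D) (X0 : smx R D) b c : lower A -> upper V ->
  (forall b c, X h b c @[h --> F] --> X0 b c) ->
  mmul A (mmul (X h) V) b c @[h --> F] --> mmul A (mmul X0 V) b c.
Proof.
move=> lA uV cX.
have E Z : mmul A (mmul Z V) b c = \sum_(d <- ball_mdeg (mdeg b))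
    A b d * \sum_(e <- ball_mdeg (mdeg c)) Z d e * V e c.
  rewrite (lower_mmulE _ _ _ lA); apply: eq_bigr => d _; congr (_ * _).
  by apply: mmul_fin => e ce; rewrite uV ?mulr0.
rewrite E; apply: (near_eq_cvgC (f := fun h => \sum_(d <- ball_mdeg (mdeg b))
    A b d * \sum_(e <- ball_mdeg (mdeg c)) X h d e * V e c)).
  by apply: filterE => h; rewrite E.
apply: cvgC_sum => d; apply: cvgC_mul; first exact: cvgC_cst.
by apply: cvgC_sum => e; apply: cvgC_mul; [exact: cX|exact: cvgC_cst].
Qed.

End DifferenceQuotients.

Arguments is_dq {R D I} F q A A0 L.

(** * The derivative of the dressing matrix and its consequences *)

Section DressingDerivative.
Context {R : realType} {D : nat}.
Context {I : Type} {F : set_system I} {FF : Filter F}.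
Variable q : I -> R[i].
Hypothesis q0 : q @ F --> (0 : R[i]).
Hypothesis qN0 : \forall h \near F, q h != 0.

(** In the application [Y] is [Upsilon gamma] and [J] the Jacobi matrix of [S0]; the other factors
    of the factorization enter only through [V]. *)
Variables (S G : I -> smx R D) (S0 G0 V Y J : smx R D).
Hypothesis uS : \forall h \near F, blower_uni (S h).
Hypothesis uS0 : blower_uni S0.
Hypothesis uSG : \forall h \near F, upper (mmul (S h) (G h)).
Hypothesis uV : upper V.
Hypothesis SGV : mmul (mmul S0 G0) V = sone.
Hypothesis rY : rfin Y.
Hypothesis rJ : rfin J.
Hypothesis JS : mmul J S0 = mmul S0 Y.
Hypothesis dG : is_dq F q G G0 (mmul Y G0).

Let rS0 := blower_uni_rfin uS0.
Let lS0 := blower_uni_lower uS0.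
Let T0 := sinv S0.
Let lZ : slower (supper J - J).
Proof. by move=> b c bc; rewrite !fctE /supper bc subrr. Qed.

Let Q h : smx R D := sscale (q h)^-1 (S h - S0).
Let U h : smx R D := mmul (Q h) T0.

Let lQ : \forall h \near F, slower (Q h).
Proof.
apply: filterS uS => h uSh b c bc.
by rewrite /Q /sscale !fctE uSh // uS0 // subrr mulr0.
Qed.

Let lU : \forall h \near F, slower (U h).
Proof. by apply: filterS lQ => h lQh; exact: slower_mmul lQh (sinv_lower uS0). Qed.

(** Matrix and, up to sign, right-hand side of the system solved by the rows of [U]: [L] tends to
    [S0 G0 V = 1], and [P] to [S0 Y G0 V = J S0 G0 V = J]. *)
Let L h : smx R D := mmul S0 (mmul (G h) V).
Let P h : smx R D := mmul S0 (mmul (sscale (q h)^-1 (G h - G0)) V).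

Let S0G0V : mmul S0 (mmul G0 V) = sone.
Proof. by rewrite -(mmulA_rc _ rS0 (upper_cfin uV)) SGV. Qed.

Let cvgL b c : L h b c @[h --> F] --> ((b == c)%:R : R[i]).
Proof.
have -> : (b == c)%:R = mmul S0 (mmul G0 V) b c by rewrite S0G0V.
apply: (@cvg_mmul_lu R D I F FF S0 V G G0 b c lS0 uV) => d e.
exact: (is_dq_cvg (FF := FF) q0 qN0 dG).
Qed.

Let cvgP b c : P h b c @[h --> F] --> J b c.
Proof.
have cV := upper_cfin uV.
have -> : J b c = mmul S0 (mmul (mmul Y G0) V) b c.
  rewrite (mmulA_rc _ rY cV) -(mmulA _ rS0 rY) -JS (mmulA _ rJ rS0).
  by rewrite S0G0V mmulx1.
apply: (@cvg_mmul_lu R D I F FF S0 V (fun h => sscale (q h)^-1 (G h - G0))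
  (mmul Y G0) b c lS0 uV) => d e.
refine (near_eq_cvgC (FF := FF) _ (@dG d e)).
by apply: filterE => h; rewrite /sscale mulrC.
Qed.

(* Rows of [(S_h - S_0) S_0^-1 / q] solve a linear system: [S_h G_h] has no
   strictly lower part, so there [(S_h - S_0) G_h V] is [- S_0 (G_h - G_0) V]. *)
Let rowU : \forall h \near F, forall b c, (mdeg c < mdeg b)%N ->
  \sum_(d <- ball_mdeg (mdeg b).-1) U h b d * L h d c = - P h b c.
Proof.
have cV := upper_cfin uV.
apply: filterS3 uS uSG lU => h uSh uSGh lUh b c cb.
have b0 : (0 < mdeg b)%N by apply: leq_ltn_trans cb.
have rSh := blower_uni_rfin uSh.
have rQ : rfin (S h - S0) by apply: rfinB.
transitivity (mmul (U h) (L h) b c).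
  (* [U h] is strictly lower, so row [b] reaches only degrees up to [(mdeg b).-1]; this is a true
     predecessor as [mdeg c < mdeg b]. *)
  apply/esym/mmul_fin => d bd.
  by rewrite lUh ?mul0r // -(prednK b0).
have rQh : rfin (Q h).
  move=> k; have [n Qn] := rQ k; exists n => d e dk ne.
  by rewrite /Q /sscale Qn // mulr0.
rewrite /U /L (mmulA _ rQh (sinv_rfin uS0)) (mmulVS _ uS0).
rewrite /P (mmulZl_c _ _ cV) (mmulZr _ _ rS0) /Q (mmulZl _ _ rQ).
rewrite (mmulBl _ rSh rS0) (mmulBl_c _ _ cV) (mmulBr _ _ rS0) S0G0V.
rewrite /sscale !fctE -mulrN opprB; congr (_ * _).
have -> : mmul (S h) (mmul (G h) V) b c = 0.
  rewrite -(mmulA_rc _ rSh cV) (@mmul_fin _ _ (mdeg c)) => [|d cd].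
    rewrite big_seq big1 // => d; rewrite mem_ball_mdeg => dc.
    by rewrite uSGh ?mul0r // (leq_ltn_trans dc).
  by rewrite uV ?mulr0.
rewrite /sone; case: eqP => [e|_]; first by rewrite e ltnn in cb.
by [].
Qed.

Let cvgU b c : U h b c @[h --> F] --> (supper J - J) b c.
Proof.
have [bc|cb] := leqP (mdeg b) (mdeg c).
  rewrite lZ //; apply: (near_eq_cvgC (f := fun=> 0)); last exact: cvgC_cst.
  by apply: filterS lU => h lUh; rewrite lUh.
apply: (cvgC_eq (z := - J b c)).
  by rewrite !fctE /supper leqNgt cb sub0r.
have cball : c \in (ball_mdeg (mdeg b).-1 : seq (midx D)).
  rewrite mem_ball_mdeg -ltnS prednK //; exact: leq_ltn_trans cb.
apply: (@cvg_row_system R I F FF _ _ (fun h => U h b) (fun h d => - P h b d) L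
  (fun d => - J b d) _ _ _ _ c cball).
- exact: fset_uniq.
- move=> d; rewrite mem_ball_mdeg -ltnS prednK; last exact: leq_ltn_trans cb.
  by move=> db; apply: filterS rowU => h ->.
- exact: cvgL.
- by move=> d; apply: cvgC_opp; exact: cvgP.
Qed.

Lemma is_dq_dressing : is_dq F q S S0 (mmul (supper J - J) S0).
Proof.
move=> b c; rewrite (lower_mmulE _ _ _ (slower_lower lZ)).
apply: (near_eq_cvgC (f := fun h =>
    \sum_(d <- ball_mdeg (mdeg b)) U h b d * S0 d c)); last first.
  by apply: cvgC_sum => d; apply: cvgC_mul; [exact: cvgU|exact: cvgC_cst].
apply: filterS2 lU lQ => h lUh lQh.
rewrite -(lower_mmulE _ _ _ (slower_lower lUh)) /U.
have [_ _ TS] := sinvP uS0.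
rewrite (mmulA _ (slower_rfin lQh) (sinv_rfin uS0)) TS mmulx1.
by rewrite /Q /sscale mulrC.
Qed.

Let lZS : lower (mmul (supper J - J) S0).
Proof. exact: lower_mmul (slower_lower lZ) lS0. Qed.

Let lS : \forall h \near F, lower (S h).
Proof. by apply: filterS uS => h; exact: blower_uni_lower. Qed.

(** With [B = supper J], the product rule gives [(B - J) S0 W0 + S0 Y W0], and [S0 Y = J S0] leaves
    [B S0 W0]. [W] is free, to be either the exponential of the times or the moment matrix. *)
Lemma is_dq_wave (W : I -> smx R D) (W0 : smx R D) :
  is_dq F q W W0 (mmul Y W0) ->
  is_dq F q (fun h => mmul (S h) (W h)) (mmul S0 W0)
    (mmul (supper J) (mmul S0 W0)).
Proof.
move=> dW; have := is_dq_mmul (FF := FF) q0 qN0 lS lS0 lZS is_dq_dressing dW.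
rewrite -(mmulA _ rS0 rY) -JS (mmulA _ rJ rS0).
rewrite (mmulA _ (slower_rfin lZ) rS0) -(mmulDl _ (slower_rfin lZ) rJ) subrK.
exact.
Qed.

(** From [S_h (S_h^-1 - S0^-1) = - (S_h - S0) S0^-1], the quotient of the inverses solves a
    triangular system with right-hand side [- U h], whose limit is known. *)
Lemma is_dq_sinv : is_dq F q (fun h => sinv (S h)) T0 (- mmul T0 (supper J - J)).
Proof.
have rZ := slower_rfin lZ; have rT0 := sinv_rfin uS0.
have cS b c : S h b c @[h --> F] --> S0 b c.
  exact: (is_dq_cvg (FF := FF) q0 qN0 is_dq_dressing).
pose X h := sscale (q h)^-1 (sinv (S h) - T0).
suff cX : forall b c, X h b c @[h --> F] --> (- mmul T0 (supper J - J)) b c.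
  move=> b c; apply: (near_eq_cvgC (FF := FF) _ (@cX b c)).
  by apply: filterE => h; rewrite /X /sscale mulrC.
apply: (cvg_lsolve (Y := fun h => - U h) uS uS0 cS).
  apply: filterS2 uS lQ => h uSh lQh.
  have [_ ST _] := sinvP uSh; have [_ S0T0 _] := sinvP uS0.
  have rSh := blower_uni_rfin uSh.
  rewrite /X /U (mmulZr _ _ rSh) (mmulBr _ _ rSh) ST /Q.
  rewrite (mmulZl _ _ (rfinB rSh rS0)) (mmulBl _ rSh rS0) S0T0.
  by apply/funext => b; apply/funext => c; rewrite /sscale !fctE -mulrN opprB.
move=> b c; rewrite (mmulNr _ rS0) (mmulSV _ uS0).
by apply: cvgC_opp; exact: cvgU.
Qed.

(** With [B = supper J], the product rule gives [(B - J) K - K (B - J)]; the terms in [J] cancel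
    because [J] commutes with [K]. *)
Lemma is_dq_jacobi (K : smx R D) (alpha : midx D) :
  K = mmul (mmul S0 (Upsilon alpha)) T0 -> mmul J K = mmul K J ->
  is_dq F q (fun h => mmul (mmul (S h) (Upsilon alpha)) (sinv (S h))) K
    (scomm (supper J) K).
Proof.
move=> KE KC; have rZ := slower_rfin lZ; have rT0 := sinv_rfin uS0.
have rU := @Upsilon_rfin R D alpha.
(* [Upsilon alpha] is not block lower triangular, so the product is grouped as [S (Upsilon T)]: a
   row shift of [T], then a product with a lower left factor. *)
have dT := is_dq_Upsilon (alpha := alpha) (FF := FF) is_dq_sinv.
have dK := is_dq_mmul (FF := FF) q0 qN0 lS lS0 lZS is_dq_dressing dT.
have rB : rfin (supper J) by exact: supper_rfin.
have rK : rfin K by rewrite KE; exact: rfin_mmul (rfin_mmul rS0 rU) rT0.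
have E : mmul (mmul (supper J - J) S0) (mmul (Upsilon alpha) T0) +
    mmul S0 (mmul (Upsilon alpha) (- mmul T0 (supper J - J))) =
    scomm (supper J) K.
  rewrite (mmulA _ rZ rS0) -(mmulA _ rS0 rU) -KE.
  rewrite (mmulNr _ rU) (mmulNr _ rS0) -(mmulA _ rS0 rU).
  rewrite -(mmulA _ (rfin_mmul rS0 rU) rT0) -KE.
  rewrite (mmulBl _ rB rJ) (mmulBr _ _ rK) KC scommE.
  by rewrite opprB addrA subrK.
have K0 : mmul S0 (mmul (Upsilon alpha) T0) = K by rewrite -(mmulA _ rS0 rU).
rewrite E K0 in dK => b c; apply: (near_eq_cvgC (FF := FF) _ (@dK b c)).
apply: filterS uS => h uSh.
by rewrite (mmulA _ (blower_uni_rfin uSh) rU).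
Qed.

End DressingDerivative.

(** * The exponential of the times *)

Section AbsoluteSums.
Context {R : realType}.
Local Open Scope complex_scope.

(** A real sequence [w] whose increments are dominated by those of [v] makes [w + v] nondecreasing
    and bounded, so [w = (w + v) - v] converges; this is applied to real and imaginary parts. *)
Lemma cvgC_dominated (s : nat -> R[i]) (v : nat -> R) (B : R) :
  (forall n m, (n <= m)%N -> norm1 (s m - s n) <= v m - v n) ->
  (forall n, v n <= B) -> exists z : R[i], s @ \oo --> z.
Proof.
move=> sv vB.
have vnd : nondecreasing_seq v.
  by move=> n m nm; rewrite -subr_ge0; apply: le_trans (sv n m nm); exact: norm1_ge0.
have cv : cvgn v.
  by apply: nondecreasing_is_cvgn => //; exists B => _ [n _ <-].
have cvg_comp (w : nat -> R) : (forall n m, (n <= m)%N ->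
    `|w m - w n| <= v m - v n) -> cvgn w.
  move=> wv; have -> : w = (fun n => w n + v n - v n) by apply/funext => n; rewrite addrK.
  apply: is_cvgB => //; apply: nondecreasing_is_cvgn.
    move=> n m /(wv n m); rewrite ler_norml => /andP[] + _.
    by rewrite -subr_ge0 => h; rewrite -subr_ge0; lra.
  (* [w n <= w 0 + v n - v 0], and [v n <= B] is used twice. *)
  exists (w 0%N + B - v 0%N + B) => _ [n _ <-].
  have := wv 0%N n isT; rewrite ler_norml => /andP[_].
  by have := vB n; lra.
have cr : cvgn (fun n => complex.Re (s n)).
  apply: cvg_comp => n m nm; apply: le_trans (sv n m nm).
  by rewrite /norm1 ReD ReN ImD ImN lerDl.
have ci : cvgn (fun n => complex.Im (s n)).
  apply: cvg_comp => n m nm; apply: le_trans (sv n m nm).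
  by rewrite /norm1 ReD ReN ImD ImN lerDr.
exists (limn (fun n => complex.Re (s n)) +i* limn (fun n => complex.Im (s n))).
by apply/cvg_ReImP; split; [exact: cr|exact: ci].
Qed.

Lemma cvgC_norm1_le (s : nat -> R[i]) (z : R[i]) (C : R) : s @ \oo --> z ->
  (forall n, norm1 (s n) <= C) -> norm1 z <= C.
Proof.
move=> /cvg_complexP sz sC; apply/ler_addgt0Pr => e e0.
have [N _ /(_ N (leqnn N)) /= se] := sz e e0.
rewrite -[z](subrK (s N)) [z - _ + _]addrC.
apply: le_trans (norm1D _ _) _; apply: lerD; first exact: sC.
by rewrite -norm1N opprB ltW.
Qed.

End AbsoluteSums.

(** * Absolutely convergent sums over the lattice *)

Section LatticeSums.
Context {R : realType} {D : nat}.
Local Open Scope complex_scope.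
Implicit Types (f g : midx D -> R[i]) (alpha b c d : midx D) (B C : R).

(** Absolute summability with its bound recorded, because powers of [C] control the exponential
    series. *)
Definition abs_bounded f C : Prop :=
  forall n, \sum_(b <- ball_mdeg n) norm1 (f b) <= C.

(** The predicate [P] allows the larger set to be a translated ball. *)
Lemma ball_sum_split (V : zmodType) (u : midx D -> V) (P : pred (midx D)) n m :
  (n <= m)%N -> (forall b, (mdeg b <= n)%N -> P b) ->
  \sum_(b <- ball_mdeg m | P b) u b - \sum_(b <- ball_mdeg n) u b =
  \sum_(b <- ball_mdeg m | P b && (n < mdeg b)%N) u b.
Proof.
move=> nm Pn; rewrite (bigID (fun b => (mdeg b <= n)%N)) /=.
rewrite [X in X + _ - _](_ : _ = \sum_(b <- ball_mdeg n) u b).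
  by rewrite addrC addKr; apply: eq_bigl => b; rewrite ltnNge.
rewrite -big_filter; apply: perm_big.
apply: uniq_perm; rewrite ?filter_uniq ?fset_uniq // => b.
rewrite !mem_filter !mem_ball_mdeg.
case bn: (mdeg b <= n)%N; rewrite ?andbF //= andbT.
by rewrite Pn // (leq_trans bn nm).
Qed.

Lemma abs_bounded_ge0 f C : abs_bounded f C -> 0 <= C.
Proof.
by move=> /(_ 0%N); apply: le_trans; apply: sumr_ge0 => b _; exact: norm1_ge0.
Qed.

Lemma msum_cvg f C : abs_bounded f C ->
  (fun n => \sum_(b <- ball_mdeg n) f b) @ \oo --> Defs.msum f.
Proof.
move=> fC; have [z cz] : exists z : R[i], (fun n => \sum_(b <- ball_mdeg n) f b) @ \oo --> z.
  apply: (cvgC_dominated (v := fun n => \sum_(b <- ball_mdeg n) norm1 (f b)) _ fC).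
  move=> n m nm; rewrite !(@ball_sum_split _ _ xpredT) //.
  exact: norm1_sum.
by rewrite msumE (cvgC_lim _ cz).
Qed.

Lemma norm1_msum f C : abs_bounded f C -> norm1 (Defs.msum f) <= C.
Proof.
move=> fC; apply: (cvgC_norm1_le (msum_cvg fC)) => n.
by apply: le_trans (fC n); exact: norm1_sum.
Qed.

Lemma msum_unique f (z : R[i]) : (fun n => \sum_(b <- ball_mdeg n) f b) @ \oo --> z ->
  Defs.msum f = z.
Proof. by move=> cz; rewrite msumE (cvgC_lim _ cz). Qed.

Lemma msumD f g B C : abs_bounded f B -> abs_bounded g C ->
  Defs.msum (fun b => f b + g b) = Defs.msum f + Defs.msum g.
Proof.
move=> /msum_cvg fB /msum_cvg gC; apply: msum_unique.
refine (near_eq_cvgC _ (cvgC_add fB gC)).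
by apply: filterE => n; rewrite big_split.
Qed.

Lemma msumZ a f C : abs_bounded f C ->
  Defs.msum (fun b => a * f b) = a * Defs.msum f.
Proof.
move=> /msum_cvg fC; apply: msum_unique.
refine (near_eq_cvgC _ (cvgC_mul (@cvgC_cst _ _ _ _ a) fC)).
by apply: filterE => n; rewrite mulr_sumr.
Qed.

Lemma mdegN b : mdeg (- b) = mdeg b.
Proof. by apply: eq_bigr => a _; rewrite ffunE abszN. Qed.

Lemma mdegB b alpha : (mdeg (b - alpha)%R <= mdeg b + mdeg alpha)%N.
Proof. by rewrite -(mdegN alpha); exact: mdegD. Qed.

Lemma ball_sum_shift (V : nmodType) (u : midx D -> V) alpha m :
  \sum_(b <- ball_mdeg m) u (b + alpha) =
  \sum_(c <- ball_mdeg (m + mdeg alpha) | (mdeg (c - alpha)%R <= m)%N) u c.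
Proof.
rewrite -[RHS]big_filter -(big_map (fun b => b + alpha) xpredT).
apply: perm_big; apply: uniq_perm; rewrite ?filter_uniq ?fset_uniq //.
  by rewrite map_inj_uniq ?fset_uniq //; exact: addIr.
move=> c; rewrite mem_filter mem_ball_mdeg; apply/mapP/andP => [[b]|[cm _]].
  by rewrite mem_ball_mdeg => bm ->; rewrite addrK (leq_trans (mdegD _ _)) ?leq_add2r.
by exists (c - alpha); rewrite ?mem_ball_mdeg // subrK.
Qed.

Lemma abs_bounded_shift f C alpha :
  abs_bounded f C -> abs_bounded (fun b => f (b + alpha)) C.
Proof.
move=> fC n; rewrite (ball_sum_shift (fun b => norm1 (f b))).
apply: le_trans (fC (n + mdeg alpha)%N); 
rewrite [leRHS](bigID (fun b => (mdeg (b - alpha)%R <= n)%N)) /= lerDl.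
by apply: sumr_ge0 => b _; exact: norm1_ge0.
Qed.

(** The ball of radius [n + k], translated by [alpha] with [k = mdeg alpha], lies between the balls
    of radius [n] and [n + 2 k]; so the two partial sums differ by at most an increment of the
    convergent sequence [v]. *)
Lemma msum_shift f C alpha : abs_bounded f C ->
  Defs.msum (fun b => f (b + alpha)) = Defs.msum f.
Proof.
move=> fC; apply: msum_unique.
pose k := mdeg alpha; pose v n := \sum_(b <- ball_mdeg n) norm1 (f b).
pose u n := \sum_(b <- ball_mdeg n) f b.
have vnd : nondecreasing_seq v.
  move=> n m nm; rewrite -subr_ge0 /v (@ball_sum_split _ _ xpredT) //.
  by apply: sumr_ge0 => b _; exact: norm1_ge0.
have cv : cvgn v by apply: nondecreasing_is_cvgn => //; exists C => _ [n _ <-]; exact: fC.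
have cf := msum_cvg fC.
have shiftE n : norm1 (\sum_(b <- ball_mdeg (n + k)) f (b + alpha) - u n) <=
    v (n + k + k)%N - v n.
  rewrite ball_sum_shift ball_sum_split; first last.
  - move=> b bn; apply: leq_trans (mdegB _ _) _; exact: leq_add.
  - by rewrite -addnA leq_addr.
  rewrite /v (@ball_sum_split _ _ xpredT) // -?addnA ?leq_addr //.
  apply: le_trans (norm1_sum _ _ _) _ => /=.
  rewrite [leLHS]big_mkcond [leRHS]big_mkcond /=; apply: ler_sum => b _.
  by case: (_ < _)%N; rewrite ?andbF ?andbT //; case: ifP => // _; exact: norm1_ge0.
apply/cvg_complexP => e e0.
have e20 : 0 < e / 2 by rewrite divr_gt0.
(* A quarter of [e] for each of the two terms of [v], and half of [e] for [u]. *)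
have /cvgrPdist_lt/(_ _ (divr_gt0 e20 (ltr0n _ 2))) : v @ \oo --> limn v by exact: cv.
move=> [N1 _ vN]; have /cvg_complexP/(_ _ e20) := cf; move=> [N2 _ fN].
exists (maxn N1 N2 + k)%N => //= n /= Nn.
pose p := (n - k)%N; have np : n = (p + k)%N by rewrite /p subnK // (leq_trans _ Nn) ?leq_addl.
have Np : (maxn N1 N2 <= p)%N by move: Nn; rewrite np leq_add2r.
rewrite geq_max in Np; case/andP: Np => N1p N2p.
have h1 := vN p N1p; have h2 := vN (p + k + k)%N; have h3 := fN p N2p.
have {}h2 := h2 (leq_trans N1p (leq_trans (leq_addr k p) (leq_addr k _))).
rewrite np -[X in norm1 X](subrKA (u p)) (splitr e).
apply: le_lt_trans (norm1D _ _) _; apply: ltrD => //.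
apply: le_lt_trans (shiftE p) _.
move: h1 h2; rewrite /= !ltr_norml => /andP[? ?] /andP[? ?]; lra.
Qed.

End LatticeSums.

(** * The exponential of a Toeplitz matrix and its first-order expansion *)

Section Exponential.
Context {R : realType} {D : nat}.
Local Open Scope complex_scope.
Implicit Types (t : times R D) (alpha b c d : midx D) (C K : R) (n : nat).

(** The matrix whose exponential is [W0 t]: at [b, c] only [alpha = c - b] contributes to the sum of
    the [t alpha * Upsilon alpha]. *)
Definition toeplitz t : smx R D := fun b c => t (c - b).

Lemma norm1_natr n : norm1 (n%:R : R[i]) = n%:R.
Proof.
by rewrite -(rmorph_nat (real_complex R)) /norm1 /= normr0 addr0 ger0_norm ?ler0n.
Qed.

Lemma norm1_realM (a : R) (z : R[i]) : norm1 (a%:C * z) = `|a| * norm1 z.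
Proof.
by case: z => x y; rewrite /norm1 /= !mul0r subr0 addr0 !normrM mulrDr.
Qed.

Lemma norm1_natVM n (z : R[i]) : norm1 (n%:R^-1 * z) = n%:R^-1 * norm1 z.
Proof.
rewrite -(rmorph_nat (real_complex R)) -fmorphV norm1_realM ger0_norm.
  by [].
by rewrite invr_ge0 ler0n.
Qed.

Lemma W0E t : W0 t = sexp (toeplitz t).
Proof.
rewrite /W0; congr sexp; apply/funext => b; apply/funext => c.
rewrite (@msum_fin _ _ (mdeg (c - b))) => [|d db].
  rewrite (@ball_sum_delta _ _ _ (c - b)) // => [|d dcb].
    by rewrite /Upsilon [b + _]addrC subrK eqxx mulr1.
  rewrite /Upsilon; case: eqP => [e|_]; last exact: mulr0.
  by rewrite -e addrC addKr eqxx in dcb.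
rewrite /Upsilon; case: eqP => [e|_]; last exact: mulr0.
by rewrite -e addrC addKr ltnn in db.
Qed.

Definition toeplitz_pow t n : smx R D := spow (toeplitz t) n.

Lemma toeplitz_powS t n b c : toeplitz_pow t n.+1 b c =
  Defs.msum (fun d => t (d - b) * toeplitz_pow t n d c).
Proof. by []. Qed.

Lemma toeplitz_bounded t C K b (x : midx D -> R[i]) : abs_bounded t C ->
  (forall d, norm1 (x d) <= K) -> abs_bounded (fun d => t (d - b) * x d) (C * K).
Proof.
move=> tC xK n; have C0 := abs_bounded_ge0 tC.
have K0 : 0 <= K by apply: le_trans (xK 0); exact: norm1_ge0.
apply: le_trans (_ : \sum_(d <- ball_mdeg n) norm1 (t (d - b)) * K <= _).
  apply: ler_sum => d _; apply: le_trans (norm1M _ _) _.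
  by apply: ler_wpM2l; [exact: norm1_ge0|exact: xK].
rewrite -mulr_suml; apply: ler_wpM2r => //.
exact: (@abs_bounded_shift _ _ t C (- b)).
Qed.

Lemma toeplitz_pow_bound t C n b c : abs_bounded t C ->
  norm1 (toeplitz_pow t n b c) <= C ^+ n.
Proof.
move=> tC; elim: n b => [|n IH] b.
  rewrite /toeplitz_pow /= /sone norm1_natr expr0.
  by case: (_ == _); rewrite ?ler01 ?lexx.
rewrite toeplitz_powS exprS; apply: norm1_msum.
by apply: toeplitz_bounded.
Qed.

Lemma toeplitz_pow_shift t C n b c alpha : abs_bounded t C ->
  toeplitz_pow t n (b + alpha) (c + alpha) = toeplitz_pow t n b c.
Proof.
move=> tC; elim: n b => [|n IH] b.
  by rewrite /toeplitz_pow /= /sone (inj_eq (addIr alpha)).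
rewrite !toeplitz_powS.
rewrite -(@msum_shift _ _ _ (C * C ^+ n) alpha); last first.
  by apply: toeplitz_bounded => // d; exact: toeplitz_pow_bound.
by congr Defs.msum; apply/funext => d; rewrite IH opprD addrACA subrr addr0.
Qed.

Lemma msum_toeplitz_pow_shift t C n b c alpha : abs_bounded t C ->
  Defs.msum (fun d => t (d - b) * toeplitz_pow t n (d + alpha) c) =
  toeplitz_pow t n.+1 (b + alpha) c.
Proof.
move=> tC; rewrite toeplitz_powS -[RHS](@msum_shift _ _ _ (C * C ^+ n) alpha); last first.
  by apply: toeplitz_bounded => // d; exact: toeplitz_pow_bound.
by congr Defs.msum; apply/funext => d; rewrite opprD addrACA subrr addr0.
Qed.

Lemma msum_shift_time t C K gamma h b (x : midx D -> R[i]) : abs_bounded t C ->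
  (forall d, norm1 (x d) <= K) ->
  Defs.msum (fun d => shift_time t gamma h (d - b) * x d) =
  Defs.msum (fun d => t (d - b) * x d) + h * x (b + gamma).
Proof.
move=> tC xK; pose g d := if d == b + gamma then h * x d else 0.
have gE : Defs.msum g = h * x (b + gamma).
  rewrite (@msum_fin _ _ (mdeg (b + gamma))) => [|d].
    rewrite (@ball_sum_delta _ _ _ (b + gamma)) // /g ?eqxx // => d /negPf -> //.
  by rewrite /g; case: eqP => // ->; rewrite ltnn.
rewrite -gE -(msumD (toeplitz_bounded b tC xK) (C := norm1 (h * x (b + gamma)))).
  congr Defs.msum; apply/funext => d.
  rewrite /shift_time /g subr_eq [gamma + b]addrC.
  by case: eqP => [->|_]; rewrite ?addr0 // mulrDl.
move=> n; have [bn|nb] := leqP (mdeg (b + gamma)) n.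
  rewrite (big_fsetD1 (b + gamma)) ?mem_ball_mdeg //= {1}/g eqxx.
  rewrite big1_fset ?addr0 // => d; rewrite !inE => /andP[/negPf dn _] _.
  by rewrite /g dn norm10.
rewrite big_seq big1 ?norm1_ge0 // => d; rewrite mem_ball_mdeg => dn.
by rewrite /g; case: eqP dn => [->|_ _]; rewrite ?norm10 // leqNgt nb.
Qed.

Lemma exp_coeff_sum_le (x : R) N : 0 <= x ->
  \sum_(0 <= n < N) x ^+ n / n`!%:R <= expR x.
Proof.
move=> x0; rewrite -[leLHS]/(series (exp_coeff x) N).
apply: nondecreasing_cvgn_le; last exact: is_cvg_series_exp_coeff.
by apply: nondecreasing_series => n _ _; exact: exp_coeff_ge0.
Qed.

Definition exp_psum (u : times R D) N b c : R[i] :=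
  series (fun n => n`!%:R^-1 * toeplitz_pow u n b c) N.

Lemma W0_cvg (u : times R D) K b c : abs_bounded u K ->
  (fun N => exp_psum u N b c) @ \oo --> W0 u b c.
Proof.
move=> uK; have K0 := abs_bounded_ge0 uK.
have [z cz] : exists z : R[i], (fun N => exp_psum u N b c) @ \oo --> z.
  apply: (cvgC_dominated (v := fun N => \sum_(0 <= n < N) K ^+ n / n`!%:R)
    (B := expR K)) => [n m nm|N]; last exact: exp_coeff_sum_le.
  have E (V : zmodType) (w : nat -> V) :
      \sum_(0 <= k < m) w k - \sum_(0 <= k < n) w k = \sum_(n <= k < m) w k.
    by rewrite (@big_cat_nat _ _ _ n 0 m) //= addrAC subrr add0r.
  rewrite /exp_psum /series /= !E; apply: le_trans (norm1_sum _ _ _) _.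
  apply: ler_sum => k _; rewrite norm1_natVM mulrC ler_wpM2r ?invr_ge0 ?ler0n //.
  exact: toeplitz_pow_bound.
by rewrite W0E /sexp (cvgC_lim _ cz).
Qed.

Section Remainder.
Variables (t : times R D) (gamma : midx D) (h : R[i]) (C : R).
Hypothesis C1 : 1 <= C.
Hypothesis tC : abs_bounded t C.
Hypothesis t'C : abs_bounded (shift_time t gamma h) C.
Let t' := shift_time t gamma h.

(* First-order Taylor remainder in [h] of the [n]-th power. *)
Let rem n b c := toeplitz_pow t' n b c - toeplitz_pow t n b c -
  h * (n%:R * toeplitz_pow t n.-1 (b + gamma) c).

Let tpow0 n b c : norm1 (toeplitz_pow t n b c) <= C ^+ n.
Proof. exact: toeplitz_pow_bound. Qed.

Let tpowB n b c : norm1 (h * (n%:R * toeplitz_pow t n.-1 (b + gamma) c)) <=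
  norm1 h * (n%:R * C ^+ n.-1).
Proof.
apply: le_trans (norm1M _ _) _; apply: ler_wpM2l; first exact: norm1_ge0.
apply: le_trans (norm1M _ _) _; rewrite norm1_natr.
by apply: ler_wpM2l; [exact: ler0n|exact: tpow0].
Qed.

Let rem_bounded n b c :
  norm1 (rem n b c) <= C ^+ n + C ^+ n + norm1 h * (n%:R * C ^+ n.-1).
Proof.
rewrite /rem; apply: le_trans (norm1D _ _) _; apply: lerD; last by rewrite norm1N.
apply: le_trans (norm1D _ _) _; rewrite norm1N; apply: lerD; last exact: tpow0.
exact: toeplitz_pow_bound.
Qed.

(** Write [A' = A + h Y] for the shifted Toeplitz matrix, where [Y = Upsilon gamma] commutes with
    [A]. Applying [A'] to [A'^n = rem n + A^n + n h Y A^(n-1)] leaves, beyond the first-order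
    expansion of [A'^(n+1)], the terms [A' (rem n)] and [n h^2 Y^2 A^(n-1)]. *)
Let remS n b c : rem n.+1 b c = Defs.msum (fun d => t' (d - b) * rem n d c) +
  h * (h * (n%:R * toeplitz_pow t n.-1 (b + gamma + gamma) c)).
Proof.
pose x d := toeplitz_pow t n d c.
pose y d := h * (n%:R * toeplitz_pow t n.-1 (d + gamma) c).
have xb d : norm1 (x d) <= C ^+ n by exact: tpow0.
have yb d : norm1 (y d) <= norm1 h * (n%:R * C ^+ n.-1) by exact: tpowB.
have E : toeplitz_pow t' n.+1 b c = Defs.msum (fun d => t' (d - b) * rem n d c) +
    (Defs.msum (fun d => t' (d - b) * x d) + Defs.msum (fun d => t' (d - b) * y d)).
  rewrite -(msumD (toeplitz_bounded b t'C xb) (toeplitz_bounded b t'C yb)).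
  rewrite -(msumD (toeplitz_bounded b t'C (fun d => rem_bounded n d c))
    (C := C * (C ^+ n + norm1 h * (n%:R * C ^+ n.-1)))).
    rewrite toeplitz_powS; congr Defs.msum; apply/funext => d.
    by rewrite -!mulrDr /rem /x /y; congr (_ * _); ring.
  under eq_fun do rewrite -mulrDr.
  apply: toeplitz_bounded => // d; apply: le_trans (norm1D _ _) _.
  by apply: lerD; [exact: xb|exact: yb].
have yE : Defs.msum (fun d => t (d - b) * y d) =
    h * (n%:R * toeplitz_pow t n (b + gamma) c).
  (* At [n = 0] the truncated [n.-1] is harmless, being multiplied by [n]. *)
  case: n @y {x xb yb E} => [|m] y.
    rewrite mul0r mulr0 (@msum_fin _ _ 0) ?big1 // => d _;
      by rewrite /y mul0r !mulr0.
  rewrite -(msum_toeplitz_pow_shift _ _ _ _ tC).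
  rewrite mulrA -(msumZ _ (toeplitz_bounded b tC (fun d => tpow0 m (d + gamma) c))).
  by congr Defs.msum; apply/funext => d; rewrite /y; ring.
rewrite {1}/rem E (msum_shift_time _ _ _ tC xb) (msum_shift_time _ _ _ tC yb) yE.
rewrite -toeplitz_powS -natr1 /y /x /=.
move: (Defs.msum _) => z; ring.
Qed.

(** Induction along [remS]: the coefficient grows from [n^2] to at most [n^2 + n <= (n + 1)^2].
    Since [1 <= C], the power [C^(n-1)] may be replaced by [C^(n+1)]. *)
Let rem_le n b c : norm1 (rem n b c) <= norm1 h ^+ 2 * (n%:R ^+ 2 * C ^+ n).
Proof.
have C0 : 0 <= C by apply: le_trans C1.
elim: n b c => [|n IH] b c.
  by rewrite /rem mul0r mulr0 subr0 /toeplitz_pow /= subrr norm10 expr0n /= mul0r mulr0.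
rewrite remS; apply: le_trans (norm1D _ _) _.
have h1 : norm1 (Defs.msum (fun d => t' (d - b) * rem n d c)) <=
    C * (norm1 h ^+ 2 * (n%:R ^+ 2 * C ^+ n)).
  by apply: norm1_msum; apply: toeplitz_bounded.
have h2 : norm1 (h * (h * (n%:R * toeplitz_pow t n.-1 (b + gamma + gamma) c))) <=
    norm1 h ^+ 2 * (n%:R * C ^+ n.+1).
  apply: le_trans (norm1M _ _) _; rewrite expr2 -mulrA.
  apply: ler_wpM2l; first exact: norm1_ge0.
  apply: le_trans (tpowB n (b + gamma) c) _.
  apply: ler_wpM2l; first exact: norm1_ge0.
  apply: ler_wpM2l; first exact: ler0n.
  by apply: ler_weXn2l => //; apply: leq_trans (leq_pred _) (leqnSn _).
apply: le_trans (lerD h1 h2) _.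
rewrite -subr_ge0 (_ : _ - _ = norm1 h ^+ 2 * (C * C ^+ n) * (n%:R + 1)).
  by rewrite !mulr_ge0 ?exprn_ge0 ?norm1_ge0 ?addr_ge0.
by have XS := exprS C n; rewrite -natr1 XS; ring.
Qed.

(** The constant comes from [n^2 <= 4^n] in [rem_le], which turns the remainders of the powers into
    the exponential series at [4 * C]. *)
Lemma W0_remainder b c :
  norm1 (W0 t' b c - W0 t b c - h * W0 t (b + gamma) c) <=
  norm1 h ^+ 2 * expR (4 * C).
Proof.
have C0 : 0 <= C by apply: le_trans C1.
have c1 := @W0_cvg t' C b c t'C; have c2 := @W0_cvg t C b c tC.
have c3 := @W0_cvg t C (b + gamma) c tC.
have cS (s : nat -> R[i]) (z : R[i]) : s @ \oo --> z -> (fun n => s n.+1) @ \oo --> z.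
  move=> /cvg_complexP sz; apply/cvg_complexP => e /sz [N _ sN].
  by exists N => // n /= Nn; apply: sN; exact: leqW.
(* Differentiation lowers the degree by one, so partial sums of length [N.+1] are compared with one
   of length [N]. *)
have c4 : (fun N => exp_psum t' N.+1 b c - exp_psum t N.+1 b c -
    h * exp_psum t N (b + gamma) c) @ \oo -->
    W0 t' b c - W0 t b c - h * W0 t (b + gamma) c.
  apply: cvgC_sub; last by apply: cvgC_mul; [exact: cvgC_cst|exact: c3].
  by apply: cvgC_sub; [exact: (cS _ _ c1)|exact: (cS _ _ c2)].
apply: (cvgC_norm1_le c4) => N.
have -> : exp_psum t' N.+1 b c - exp_psum t N.+1 b c - h * exp_psum t N (b + gamma) c =
    \sum_(0 <= n < N.+1) n`!%:R^-1 * rem n b c.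
  rewrite /exp_psum /series /= /rem.
  under [RHS]eq_bigr do rewrite !mulrBr.
  rewrite !sumrB; congr (_ - _).
  rewrite big_nat_recl // mul0r !mulr0 add0r mulr_sumr; apply: eq_bigr => n _.
  have nz : (n.+1%:R : R[i]) != 0 by rewrite pnatr_eq0.
  rewrite factS natrM invfM /=.
  move: (n`!%:R^-1) (toeplitz_pow t n _ c) (n.+1%:R) nz => u x m m0.
  by field.
apply: le_trans (norm1_sum _ _ _) _.
apply: le_trans (ler_wpM2l _ (@exp_coeff_sum_le (4 * C) N.+1 _)); last 2 first.
- by rewrite exprn_ge0 // norm1_ge0.
- by rewrite mulr_ge0.
rewrite mulr_sumr; apply: ler_sum => n _; rewrite norm1_natVM mulrA [leLHS]mulrC.
apply: ler_wpM2r; first by rewrite invr_ge0 ler0n.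
apply: le_trans (rem_le n b c) _; apply: ler_wpM2l; first by rewrite exprn_ge0 ?norm1_ge0.
rewrite exprMn ler_wpM2r ?exprn_ge0 // -!natrX ler_nat.
rewrite (_ : 4 = 2 ^ 2)%N // -expnM mulnC expnM leq_exp2r //.
by apply: ltnW; exact: ltn_expl.
Qed.

End Remainder.

Lemma W0_shift t C b c alpha : abs_bounded t C ->
  W0 t (b + alpha) (c + alpha) = W0 t b c.
Proof.
move=> tC; rewrite W0E /sexp; congr (lim (series _ @ \oo)).
apply/funext => n; congr (_ * _); exact: (@toeplitz_pow_shift t C).
Qed.

End Exponential.

(** * Quadratic remainder of the complex exponential *)

Section ComplexExponential.
Context {R : realType}.
Local Open Scope complex_scope.
Implicit Types (x y : R) (z w : R[i]).

Lemma norm_sin_le y : `|sin y| <= `|y|.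
Proof.
wlog y0 : y / 0 <= y => [H|].
  have [y0|/ltW y0] := leP 0 y; first exact: H.
  by rewrite -normrN -sinN -(normrN y) H // oppr_ge0.
have [|c _] := @MVT_segment R (@sin R) (@cos R) 0 y y0 (fun x _ => is_derive_sin x).
  exact/continuous_subspaceT/continuous_sin.
rewrite sin0 !subr0 => ->; rewrite normrM ler_piMl //; exact: cos_max.
Qed.

(** By the mean value theorem [cos y - 1 = - sin c * y] with [c] between [0] and [y], and [sin c] is
    at most [c] in absolute value. *)
Lemma norm_cos_sub1_le y : `|cos y - 1| <= y ^+ 2.
Proof.
wlog y0 : y / 0 <= y => [H|].
  have [y0|/ltW y0] := leP 0 y; first exact: H.
  by rewrite -cosN -sqrrN H // oppr_ge0.
have [|c] := @MVT_segment R (@cos R) (fun x => - sin x) 0 y y0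
    (fun x _ => is_derive_cos x).
  exact/continuous_subspaceT/continuous_cos.
rewrite in_itv /= => /andP[c0 cy]; rewrite cos0 subr0 => ->.
rewrite normrM normrN expr2 (ger0_norm y0) ler_wpM2r //.
by apply: le_trans (norm_sin_le c) _; rewrite ger0_norm.
Qed.

Lemma norm_sin_sub_le y : `|y| <= 1 -> `|sin y - y| <= y ^+ 2.
Proof.
wlog y0 : y / 0 <= y => [H|].
  have [y0|/ltW y0] := leP 0 y; first exact: H.
  have := H (- y); rewrite oppr_ge0 normrN sqrrN sinN -opprD normrN; exact.
rewrite (ger0_norm y0) => y1.
have [|c] := @MVT_segment R (@sin R) (@cos R) 0 y y0 (fun x _ => is_derive_sin x).
  exact/continuous_subspaceT/continuous_sin.
rewrite in_itv /= => /andP[c0 cy]; rewrite sin0 !subr0 => ->.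
rewrite -{2}(mul1r y) -mulrBl normrM expr2 (ger0_norm y0) ler_wpM2r //.
apply: le_trans (norm_cos_sub1_le c) _.
by rewrite expr2; apply: le_trans (ler_pM c0 c0 cy cy) _; rewrite ler_piMr.
Qed.

Lemma expR_le_inv x : x < 1 -> expR x <= (1 - x)^-1.
Proof.
move=> x1; rewrite -[x in expR x]opprK expRN lef_pV2 ?posrE ?expR_gt0 ?subr_gt0 //.
exact: expR_ge1Dx.
Qed.

(** [1 + x <= expR x <= 1 / (1 - x)], and the gap [1 / (1 - x) - 1 - x = x^2 / (1 - x)] is at most
    [2 x^2] for [x <= 1 / 2]. *)
Lemma expR_remainder x : `|x| <= 1 / 2 ->
  expR x <= 2 /\ `|expR x - 1 - x| <= 2 * x ^+ 2.
Proof.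
move=> xh; have [xl xu] : - (1 / 2) <= x /\ x <= 1 / 2.
  by move: xh; rewrite ler_norml => /andP[].
have e1 := expR_ge1Dx x.
have e2 : expR x <= (1 - x)^-1 by apply: expR_le_inv; lra.
have i0 : 0 < (1 - x)^-1 by rewrite invr_gt0; lra.
have i1 : (1 - x)^-1 * (1 - x) = 1 by rewrite mulVf // gt_eqF //; lra.
set i := (1 - x)^-1 in e2 i0 i1 *.
have i2 : i <= 2 by nra.
split; first by lra.
rewrite ger0_norm; last by lra.
have : i - 1 - x = i * x ^+ 2 by rewrite expr2; nra.
have : 0 <= x ^+ 2 by exact: sqr_ge0.
by nra.
Qed.

Lemma cexpD z w : cexp (z + w) = cexp z * cexp w.
Proof.
case: z w => [a b] [c d]; rewrite /cexp /= expRD cosD sinD.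
by apply: complexP => /=; ring.
Qed.

(** The real part contributes [2 x^2 + 2 y^2] and the imaginary part [2 y^2 + 2 |x| |y|]; together
    they stay below [4 (|x| + |y|)^2]. *)
Lemma cexp_remainder w : norm1 w <= 1 / 2 ->
  norm1 (cexp w - 1 - w) <= 4 * norm1 w ^+ 2.
Proof.
case: w => x y; rewrite /norm1 /cexp.
rewrite !(ReD, ReN, ImD, ImN, ReM, ImM) /= !mul0r subr0 addr0 subr0 => xy.
have nx := normr_ge0 x; have ny := normr_ge0 y.
have [e2 er] := @expR_remainder x ltac:(lra).
have e0 := expR_gt0 x.
have c1 := norm_cos_sub1_le y.
have s1 := @norm_sin_sub_le y ltac:(lra).
have hr : `|expR x * cos y - 1 - x| <= 2 * `|x| ^+ 2 + 2 * `|y| ^+ 2.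
  rewrite (_ : _ - x = (expR x - 1 - x) + expR x * (cos y - 1)); last by ring.
  apply: le_trans (ler_normD _ _) _; rewrite !real_normK ?num_real //.
  apply: lerD => //; rewrite normrM (ger0_norm (ltW e0)).
  by apply: ler_pM => //; exact: ltW.
have hi : `|expR x * sin y - y| <= 2 * `|y| ^+ 2 + 2 * (`|x| * `|y|).
  rewrite (_ : _ - y = expR x * (sin y - y) + ((expR x - 1 - x) + x) * y); last by ring.
  apply: le_trans (ler_normD _ _) _; apply: lerD.
    rewrite normrM (ger0_norm (ltW e0)) real_normK ?num_real //.
    by apply: ler_pM => //; exact: ltW.
  rewrite normrM mulrA; apply: ler_wpM2r => //.
  apply: le_trans (ler_normD _ _) _; move: er; rewrite -real_normK ?num_real // => er.
  by nra.
by nra.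
Qed.

End ComplexExponential.

(** * From quadratic remainders to time derivatives *)

Section TimeDerivatives.
Context {R : realType} {D : nat}.
Local Open Scope complex_scope.
Implicit Types (A : set R[i]) (h : R[i]).

Lemma near_within_dnbhs0 A (e : R) : 0 < e ->
  \forall h \near within A (0 : R[i])^', [/\ A h, h != 0 & norm1 h < e].
Proof.
move=> e0; apply/nbhs_complexP; exists e => // h; rewrite subr0 => he h0 Ah.
by split.
Qed.

Lemma within_dnbhs0_cvg A : h @[h --> within A (0 : R[i])^'] --> (0 : R[i]).
Proof.
apply/cvg_complexP => e e0; apply: filterS (near_within_dnbhs0 A e0) => h [_ _].
by rewrite subr0.
Qed.

Lemma within_dnbhs0_neq A : \forall h \near within A (0 : R[i])^', h != 0.
Proof. by apply: filterS (near_within_dnbhs0 A ltr01) => h []. Qed.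

(** For [h = x + i y] the product is [(|x| + |y|)^2 / (x^2 + y^2)]. *)
Lemma norm1_inv h : h != 0 -> norm1 h^-1 * norm1 h <= 2.
Proof.
case: h => x y h0; rewrite /norm1 /=.
have n0 : 0 < x ^+ 2 + y ^+ 2.
  rewrite lt_neqAle addr_ge0 ?sqr_ge0 // andbT eq_sym paddr_eq0 ?sqr_ge0 //.
  by rewrite !sqrf_eq0; move: h0; rewrite eq_complex.
have iN : `|(x ^+ 2 + y ^+ 2)^-1| = (x ^+ 2 + y ^+ 2)^-1.
  by rewrite ger0_norm // invr_ge0 ltW.
rewrite normrN !normrM iN.
rewrite -mulrDl mulrAC ler_pdivrMr // -(real_normK (num_real x)) -(real_normK (num_real y)).
have := sqr_ge0 (`|x| - `|y|); rewrite !expr2; nra.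
Qed.

Lemma cvg_quotient A (K e : R) (f : R[i] -> R[i]) (f0 l : R[i]) : 0 < e ->
  (forall h, A h -> norm1 h < e -> norm1 (f h - f0 - h * l) <= norm1 h ^+ 2 * K) ->
  (f h - f0) / h @[h --> within A (0 : R[i])^'] --> l.
Proof.
move=> e0 fK; apply/cvg_complexP => d d0.
(* By [norm1_inv] the error of the quotient is at most [2 |K| norm1 h]; the added [1] makes [M]
   positive. *)
pose M := 2 * `|K| + 1.
have M0 : 0 < M by rewrite /M ltr_wpDl ?mulr_ge0.
have m0 : 0 < Num.min e (d / M) by rewrite lt_min e0 divr_gt0.
apply: filterS (near_within_dnbhs0 A m0) => h [Ah h0].
rewrite lt_min => /andP[he hd].
have -> : (f h - f0) / h - l = h^-1 * (f h - f0 - h * l).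
  by rewrite mulrBr mulrA mulVf // mul1r [RHS]addrC mulrC [RHS]addrC.
apply: le_lt_trans (norm1M _ _) _.
have i0 := norm1_ge0 h^-1; have n0 := norm1_ge0 h; have i2 := norm1_inv h0.
have kk := ler_norm K; have k0 := normr_ge0 K.
have r0 : norm1 (f h - f0 - h * l) <= norm1 h ^+ 2 * `|K|.
  apply: le_trans (fK h Ah he) _; apply: ler_wpM2l => //; exact: exprn_ge0.
apply: le_lt_trans (ler_wpM2l i0 r0) _.
rewrite [ltLHS](_ : _ = norm1 h^-1 * norm1 h * (norm1 h * `|K|)); last by ring.
apply: le_lt_trans (ler_wpM2r (mulr_ge0 n0 k0) i2) _.
rewrite ltr_pdivlMr // in hd; apply: le_lt_trans hd.
by rewrite /M; nra.
Qed.

Lemma times_summable_bounded (t : times R D) : times_summable t ->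
  exists C, abs_bounded t C.
Proof.
rewrite /times_summable summableE => /fineK; set S := esum _ _ => SE.
exists (2 * fine S) => n.
apply: le_trans (_ : \sum_(b <- ball_mdeg n) 2 * complex.Re `|t b| <= _).
  by apply: ler_sum => b _; exact: norm1_le.
rewrite -mulr_sumr; apply: ler_wpM2l => //.
rewrite -lee_fin SE; apply: esum_ge.
exists [set b : midx D | (mdeg b <= n)%N].
  by split; [exact: finite_mdeg_le|].
rewrite fsbig_finite; last exact: finite_mdeg_le.
rewrite -sumEFin; apply: lee_sum => b _; rewrite lee_fin; exact: ler_norm.
Qed.

Lemma shift_time_bounded (t : times R D) C gamma h : abs_bounded t C ->
  norm1 h <= 1 -> abs_bounded (shift_time t gamma h) (C + 1).
Proof.
move=> tC h1 n.
pose g b : R := if b == gamma then norm1 h else 0.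
apply: le_trans (_ : \sum_(b <- ball_mdeg n) (norm1 (t b) + g b) <= _).
  apply: ler_sum => b _; rewrite /shift_time /g; case: eqP => [->|_].
    exact: norm1D.
  by rewrite addr0.
rewrite big_split /=; apply: lerD => //; apply: le_trans h1.
have [gn|ng] := leqP (mdeg gamma) n.
  rewrite (big_fsetD1 gamma) ?mem_ball_mdeg //= {1}/g eqxx.
  rewrite big1_fset ?addr0 // => d; rewrite !inE => /andP[/negPf dn _] _.
  by rewrite /g dn.
rewrite big_seq big1 ?norm1_ge0 // => d; rewrite mem_ball_mdeg => dn.
by rewrite /g; case: eqP dn => [->|//]; rewrite leqNgt ng.
Qed.

Lemma is_dq_W0 A (t : times R D) gamma : times_summable t ->
  is_dq (within A (0 : R[i])^') id (fun h => W0 (shift_time t gamma h)) (W0 t)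
    (mmul (Upsilon gamma) (W0 t)).
Proof.
move=> /times_summable_bounded[C tC] b c; rewrite mmul_Upsilonl.
have C0 := abs_bounded_ge0 tC.
(* For [norm1 h < 1] the constant [C + 1] bounds both the times and the shifted times, and it is at
   least [1], as [W0_remainder] requires. *)
apply: (@cvg_quotient _ (expR (4 * (C + 1))) 1) => // h _ h1.
apply: W0_remainder; first by rewrite lerDr.
  by move=> n; apply: le_trans (tC n) _; rewrite lerDl.
by apply: shift_time_bounded => //; exact: ltW.
Qed.

End TimeDerivatives.

(** * Moments of the deformed measure *)

Section TorusIntegration.
Context {R : realType} {D : nat}.
Local Open Scope complex_scope.
Implicit Types (f g : torus R D -> R) (F G : torus R D -> R[i]).

(** [torus] carries the topology and [borel_torus] the sigma-algebra on the same points; the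
    ascription selects the latter for functions declared on [torus]. *)
Definition torus_meas f : Prop :=
  measurable_fun [set: borel_torus R D] (f : borel_torus R D -> R).

Lemma continuous_torus_meas f : continuous f -> torus_meas f.
Proof.
move=> /continuousP cf; apply: (measurability _ (RGenOpens.measurableE R)).
move=> _ [_ [a [b ->] <-]]; rewrite setTI; apply: sub_sigma_algebra.
exact/cf/interval_open.
Qed.

Lemma torus_meas_cst (r : R) : torus_meas (fun=> r).
Proof. exact: measurable_cst. Qed.

Lemma torus_measD f g : torus_meas f -> torus_meas g -> torus_meas (fun z => f z + g z).
Proof. exact: measurable_funD. Qed.

Lemma torus_measB f g : torus_meas f -> torus_meas g -> torus_meas (fun z => f z - g z).
Proof. exact: measurable_funB. Qed.

Lemma torus_measM f g : torus_meas f -> torus_meas g -> torus_meas (fun z => f z * g z).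
Proof. exact: measurable_funM. Qed.

Lemma torus_measN f : torus_meas f -> torus_meas (fun z => - f z).
Proof. by move=> mf; apply: measurableT_comp. Qed.

Lemma torus_meas_comp (u : R -> R) f : continuous u -> torus_meas f -> torus_meas (fun z => u (f z)).
Proof.
move=> cu mf; apply: (measurableT_comp _ mf).
exact: continuous_measurable_fun.
Qed.

Lemma torus_meas_cvg (u : nat -> torus R D -> R) f : (forall n, torus_meas (u n)) ->
  (forall z, u n z @[n --> \oo] --> f z) -> torus_meas f.
Proof. by move=> mu cu; apply: (measurable_fun_cvg mu) => z _; exact: cu. Qed.

Section Jordan.
Variable mu : {finite_measure set (borel_torus R D) -> \bar R}.

Lemma torus_meas_integrable f (M : R) : torus_meas f -> (forall z, `|f z| <= M) ->
  mu.-integrable [set: borel_torus R D] (EFin \o (f : borel_torus R D -> R)).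
Proof.
move=> mf fM; apply: measurable_bounded_integrable => //.
  by rewrite ltey_eq fin_num_measure.
exists M; split; first exact: num_real.
by move=> x Mx z _ /=; apply: le_trans (fM z) (ltW Mx).
Qed.

Lemma norm_Rintegral_le f (M : R) : torus_meas f -> (forall z, `|f z| <= M) ->
  `|Rintegral mu [set: borel_torus R D] f| <= M * fine (mu setT).
Proof.
move=> mf fM; have If := torus_meas_integrable mf fM.
apply: le_trans (le_normr_Rintegral _ If) _ => //.
rewrite -[leRHS](Rintegral_cst mu) //; apply: le_Rintegral => //.
- exact: integrable_norm.
- apply: (@torus_meas_integrable (fun=> M) `|M|); first exact: torus_meas_cst.
  by move=> z.
Qed.

End Jordan.

Section Charge.
Variable nu : {charge set (borel_torus R D) -> \bar R}.

Lemma charge_integralD f g (M N : R) : torus_meas f -> (forall z, `|f z| <= M) ->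
  torus_meas g -> (forall z, `|g z| <= N) ->
  charge_integral nu (fun z => f z + g z) =
  charge_integral nu f + charge_integral nu g.
Proof.
move=> mf fM mg gN; rewrite /charge_integral.
rewrite !RintegralD //; first (by ring);
  by [apply: torus_meas_integrable fM|apply: torus_meas_integrable gN].
Qed.

Lemma charge_integralZ f (M a : R) : torus_meas f -> (forall z, `|f z| <= M) ->
  charge_integral nu (fun z => a * f z) = a * charge_integral nu f.
Proof.
move=> mf fM; rewrite /charge_integral.
by rewrite !RintegralZl ?mulrBr //; apply: torus_meas_integrable fM.
Qed.

(** [K] is the total mass of the two parts of the Jordan decomposition, that is, of the total
    variation. *)
Lemma norm_charge_integral_le : exists K : R, forall f (M : R), torus_meas f ->
  (forall z, `|f z| <= M) -> `|charge_integral nu f| <= M * K.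
Proof.
pose P := jordan_pos (svalP (hahn_of nu)); pose N := jordan_neg (svalP (hahn_of nu)).
exists (fine (P setT) + fine (N setT)) => f M mf fM.
rewrite /charge_integral mulrDr; apply: le_trans (ler_normB _ _) _.
by apply: lerD; exact: norm_Rintegral_le.
Qed.

End Charge.

(** Boundedness gives integrability against the finite parts of every charge, and the class is
    stable under all operations that build the integrands. *)
Definition bounded_meas F : Prop := [/\ torus_meas (fun z => complex.Re (F z)),
  torus_meas (fun z => complex.Im (F z)) & exists M : R, forall z, norm1 (F z) <= M].

Lemma norm_Re_le (w : R[i]) : `|complex.Re w| <= norm1 w.
Proof. by rewrite /norm1 lerDl. Qed.

Lemma norm_Im_le (w : R[i]) : `|complex.Im w| <= norm1 w.
Proof. by rewrite /norm1 lerDr. Qed.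

Lemma bounded_meas_cst (w : R[i]) : bounded_meas (fun=> w).
Proof. by split; [exact: torus_meas_cst|exact: torus_meas_cst|exists (norm1 w)]. Qed.

Lemma bounded_measD F G : bounded_meas F -> bounded_meas G -> bounded_meas (fun z => F z + G z).
Proof.
move=> [f1 f2 [M fM]] [g1 g2 [N gN]]; split.
- by under eq_fun do rewrite ReD; exact: torus_measD.
- by under eq_fun do rewrite ImD; exact: torus_measD.
- by exists (M + N) => z; apply: le_trans (norm1D _ _) _; apply: lerD.
Qed.

Lemma bounded_measM F G : bounded_meas F -> bounded_meas G -> bounded_meas (fun z => F z * G z).
Proof.
move=> [f1 f2 [M fM]] [g1 g2 [N gN]]; split.
- apply: (@eq_ind _ _ torus_meas (torus_measB (torus_measM f1 g1) (torus_measM f2 g2))).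
  by apply/funext => z; case: (F z) (G z) => [? ?] [? ?].
- apply: (@eq_ind _ _ torus_meas (torus_measD (torus_measM f1 g2) (torus_measM f2 g1))).
  by apply/funext => z; case: (F z) (G z) => [? ?] [? ?].
- exists (M * N) => z; apply: le_trans (norm1M _ _) _.
  by apply: ler_pM; rewrite ?norm1_ge0.
Qed.

Lemma bounded_meas_conj F : bounded_meas F -> bounded_meas (fun z => (F z)^*).
Proof.
move=> [f1 f2 [M fM]]; split.
- by rewrite (_ : (fun z => _) = (fun z => complex.Re (F z))) //;
    apply/funext => z; case: (F z).
- rewrite (_ : (fun z => _) = (fun z => - complex.Im (F z))); first exact: torus_measN.
  by apply/funext => z; case: (F z).
- by exists M => z; rewrite norm1_conj.
Qed.

Lemma bounded_meas_prod (I : Type) (r : seq I) (F : I -> torus R D -> R[i]) :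
  (forall i, bounded_meas (F i)) -> bounded_meas (fun z => \prod_(i <- r) F i z).
Proof.
move=> gF; elim: r => [|i r IH].
  by under eq_fun do rewrite big_nil; exact: bounded_meas_cst.
by under eq_fun do rewrite big_cons; exact: bounded_measM.
Qed.

Lemma bounded_meas_sum (I : Type) (r : seq I) (F : I -> torus R D -> R[i]) :
  (forall i, bounded_meas (F i)) -> bounded_meas (fun z => \sum_(i <- r) F i z).
Proof.
move=> gF; elim: r => [|i r IH].
  by under eq_fun do rewrite big_nil; exact: bounded_meas_cst.
by under eq_fun do rewrite big_cons; exact: bounded_measD.
Qed.

Lemma bounded_measX F n : bounded_meas F -> bounded_meas (fun z => F z ^+ n).
Proof.
move=> gF; elim: n => [|n IH]; first exact: bounded_meas_cst.
by under eq_fun do rewrite exprS; exact: bounded_measM.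
Qed.

Lemma bounded_meas_cexp F : bounded_meas F -> bounded_meas (fun z => cexp (F z)).
Proof.
move=> [f1 f2 [M fM]].
have E z : cexp (F z) = expR (complex.Re (F z)) * cos (complex.Im (F z)) +i*
    (expR (complex.Re (F z)) * sin (complex.Im (F z))).
  by apply: complexP; rewrite /cexp /=; ring.
split.
- under eq_fun do rewrite E /=; apply: torus_measM; apply: torus_meas_comp => //.
    exact: continuous_expR.
  exact: continuous_cos.
- under eq_fun do rewrite E /=; apply: torus_measM; apply: torus_meas_comp => //.
    exact: continuous_expR.
  exact: continuous_sin.
- exists (expR M + expR M) => z; rewrite E /norm1 /=; apply: lerD; rewrite normrM.
  + rewrite -[leRHS]mulr1; apply: ler_pM => //; last exact: cos_max.
    rewrite ger0_norm ?expR_ge0 // ler_expR.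
    by apply: le_trans (ler_norm _) (le_trans (norm_Re_le _) (fM z)).
  + rewrite -[leRHS]mulr1; apply: ler_pM => //; last exact: sin_max.
    rewrite ger0_norm ?expR_ge0 // ler_expR.
    by apply: le_trans (ler_norm _) (le_trans (norm_Re_le _) (fM z)).
Qed.

Lemma torus_coordE (z : torus R D) a :
  (val z ord0 a) * (val z ord0 a)^* = 1.
Proof.
have /set_mem /(_ a) /= za := valP z.
by rewrite -sqr_normc za expr1n.
Qed.

Lemma continuous_coord a :
  continuous (fun z : torus R D => val z ord0 a : R[i]).
Proof.
move=> z B nB.
have cval : continuous (set_val : torus R D -> 'rV[R[i]]_D) by exact: initial_continuous.
(* The neighbourhood of the row vector is a product of entrywise neighbourhoods, constrained at the
   coordinate [a] only. *)
have nB' : nbhs (set_val z : 'rV[R[i]]_D) [set M | B (M ord0 a)].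
  exists (fun _ j => [set x | j = a -> B x]) => [i j|M]; last by move/(_ ord0 a); apply.
  have [ja|/eqP ja] := eqVneq j a; last by apply: filterS filterT => x _ /ja.
  by rewrite ja (ord1 i); apply: filterS nB => x Bx _.
exact: cval nB'.
Qed.

Lemma bounded_meas_coord a : bounded_meas (fun z : torus R D => val z ord0 a).
Proof.
split.
- by apply: continuous_torus_meas => z; have /cvg_ReImP[] := @continuous_coord a z.
- by apply: continuous_torus_meas => z; have /cvg_ReImP[] := @continuous_coord a z.
exists 2 => z; apply: le_trans (norm1_le _) _.
have /set_mem /(_ a) /= za := valP z.
rewrite -[leRHS]mulr1; apply: ler_wpM2l => //; rewrite le_eqVlt.
by apply/orP; left; apply/eqP; exact: (congr1 (@complex.Re R) za).
Qed.

Lemma torus_coordV (z : torus R D) a : (val z ord0 a)^-1 = (val z ord0 a)^*.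
Proof.
have E := torus_coordE z a.
have z0 : val z ord0 a != 0 by apply: contra_eq_neq E => ->; rewrite mul0r eq_sym oner_eq0.
by apply: (mulfI z0); rewrite E divff.
Qed.

Lemma torus_coord_neq0 (z : torus R D) a : val z ord0 a != 0.
Proof.
by apply: contra_eq_neq (torus_coordE z a) => ->; rewrite mul0r eq_sym oner_eq0.
Qed.

Lemma bounded_meas_monomial (alpha : midx D) : bounded_meas (monomial alpha).
Proof.
apply: bounded_meas_prod => a; case: (alpha a) => n.
  exact: bounded_measX (bounded_meas_coord a).
apply: (@eq_ind _ _ bounded_meas (bounded_measX n.+1 (bounded_meas_conj (bounded_meas_coord a)))).
by apply/funext => z; rewrite -torus_coordV NegzE -exprnN exprVn.
Qed.

Lemma monomialD (alpha beta : midx D) (z : torus R D) :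
  monomial (alpha + beta) z = monomial alpha z * monomial beta z.
Proof.
rewrite -big_split /=; apply: eq_bigr => a _.
by rewrite ffunE expfzDr // torus_coord_neq0.
Qed.

Lemma monomial_conj (alpha : midx D) (z : torus R D) :
  (monomial alpha z)^* = monomial (- alpha) z.
Proof.
rewrite rmorph_prod; apply: eq_bigr => a _.
by rewrite ffunE -exprz_inv torus_coordV fmorphXz.
Qed.

Lemma monomial_shift (alpha b c : midx D) (z : torus R D) :
  monomial (c - alpha) z * (monomial b z)^* =
  monomial c z * (monomial (b + alpha) z)^*.
Proof.
transitivity (monomial (c - alpha) z * monomial (- b) z).
  by congr (_ * _); exact: monomial_conj.
transitivity (monomial c z * monomial (- (b + alpha)) z); last first.
  by congr (_ * _); rewrite -monomial_conj.
by rewrite -!monomialD opprD [- b - alpha]addrC addrA.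
Qed.

Lemma norm1_monomial (alpha : midx D) (z : torus R D) : norm1 (monomial alpha z) <= 2.
Proof.
apply: le_trans (norm1_le _) _.
rewrite /monomial normr_prod big1 ?mulr1 // => a _.
have /set_mem /(_ a) /= za := valP z.
by case: (alpha a) => n; rewrite ?NegzE -?exprnN -?exprnP ?normfV normrX za expr1n ?invr1.
Qed.

Lemma tfun_bounded (t : times R D) C (z : torus R D) : abs_bounded t C ->
  abs_bounded (fun b => t b * monomial b z) (C * 2).
Proof.
move=> tC n; apply: le_trans (ler_wpM2r _ (tC n)) => //.
rewrite mulr_suml; apply: ler_sum => b _; apply: le_trans (norm1M _ _) _.
by apply: ler_wpM2l; [exact: norm1_ge0|exact: norm1_monomial].
Qed.

Lemma bounded_meas_tfun (t : times R D) C : abs_bounded t C -> bounded_meas (tfun t).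
Proof.
move=> tC.
pose u n z := \sum_(b <- ball_mdeg n) t b * monomial b z.
have gu n : bounded_meas (u n).
  by apply: bounded_meas_sum => b; apply: bounded_measM; [exact: bounded_meas_cst|exact: bounded_meas_monomial].
have cu z : u n z @[n --> \oo] --> tfun t z := msum_cvg (tfun_bounded z tC).
split.
- apply: (@torus_meas_cvg (fun n z => complex.Re (u n z))) => [n|z]; first by have [] := gu n.
  by have /cvg_ReImP[] := cu z.
- apply: (@torus_meas_cvg (fun n z => complex.Im (u n z))) => [n|z]; first by have [] := gu n.
  by have /cvg_ReImP[] := cu z.
- by exists (C * 2) => z; apply: norm1_msum; exact: tfun_bounded.
Qed.

Lemma tfun_shift_time (t : times R D) C gamma h (z : torus R D) : abs_bounded t C ->
  tfun (shift_time t gamma h) z = tfun t z + h * monomial gamma z.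
Proof.
move=> tC; pose g b := if b == gamma then h * monomial b z else 0.
have gE : Defs.msum g = h * monomial gamma z.
  rewrite (@msum_fin _ _ (mdeg gamma)) => [|d].
    by rewrite (@ball_sum_delta _ _ _ gamma) /g ?eqxx // => d /negPf ->.
  by rewrite /g; case: eqP => // ->; rewrite ltnn.
rewrite -gE /tfun -(msumD (tfun_bounded z tC) (C := norm1 (h * monomial gamma z))).
  congr Defs.msum; apply/funext => d.
  by rewrite /shift_time /g; case: eqP => [->|_]; rewrite ?addr0 // mulrDl.
move=> n; have [bn|nb] := leqP (mdeg gamma) n.
  rewrite (big_fsetD1 gamma) ?mem_ball_mdeg //= {1}/g eqxx.
  rewrite big1_fset ?addr0 // => d; rewrite !inE => /andP[/negPf dn _] _.
  by rewrite /g dn norm10.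
rewrite big_seq big1 ?norm1_ge0 // => d; rewrite mem_ball_mdeg => dn.
by rewrite /g; case: eqP dn => [->|_ _]; rewrite ?norm10 // leqNgt nb.
Qed.

Section Linear.
Variable mu : complex_measure R D.

Lemma complex_integralD F G : bounded_meas F -> bounded_meas G ->
  complex_integral mu (fun z => F z + G z) =
  complex_integral mu F + complex_integral mu G.
Proof.
move=> [f1 f2 [M fM]] [g1 g2 [N gN]].
have fr z := le_trans (norm_Re_le (F z)) (fM z).
have fi z := le_trans (norm_Im_le (F z)) (fM z).
have gr z := le_trans (norm_Re_le (G z)) (gN z).
have gi z := le_trans (norm_Im_le (G z)) (gN z).
rewrite /complex_integral.
under [fun z => complex.Re _]eq_fun do rewrite ReD.
under [fun z => complex.Im _]eq_fun do rewrite ImD.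
rewrite !(charge_integralD _ f1 fr g1 gr) !(charge_integralD _ f2 fi g2 gi).
by apply: complexP => /=; ring.
Qed.

Lemma complex_integralZ (a : R[i]) F : bounded_meas F ->
  complex_integral mu (fun z => a * F z) = a * complex_integral mu F.
Proof.
move=> [f1 f2 [M fM]].
have fr z := le_trans (norm_Re_le (F z)) (fM z).
have fi z := le_trans (norm_Im_le (F z)) (fM z).
have Z nu c f (fm : torus_meas f) (N : R) (fN : forall z, `|f z| <= N) :=
  charge_integralZ nu c fm fN.
have b (c : R) f (N : R) (fN : forall z, `|f z| <= N) z : `|c * f z| <= `|c| * N.
  by rewrite normrM ler_wpM2l.
have m (c : R) f (fm : torus_meas f) : torus_meas (fun z => c * f z).
  by apply: torus_measM => //; exact: torus_meas_cst.
case: a => x y; rewrite /complex_integral.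
have -> : (fun z => complex.Re ((x +i* y) * F z)) =
    (fun z => x * complex.Re (F z) + (- y) * complex.Im (F z)).
  by apply/funext => z; case: (F z) => u v /=; ring.
have -> : (fun z => complex.Im ((x +i* y) * F z)) =
    (fun z => x * complex.Im (F z) + y * complex.Re (F z)).
  by apply/funext => z; case: (F z) => u v /=; ring.
rewrite !(charge_integralD _ (m x _ f1) (b x _ _ fr) (m (- y) _ f2) (b (- y) _ _ fi)).
rewrite !(charge_integralD _ (m x _ f2) (b x _ _ fi) (m y _ f1) (b y _ _ fr)).
rewrite !(charge_integralZ _ _ f1 fr) !(charge_integralZ _ _ f2 fi).
by apply: complexP => /=; ring.
Qed.

Lemma norm1_complex_integral : exists K : R, forall F (M : R), bounded_meas F ->
  (forall z, norm1 (F z) <= M) -> norm1 (complex_integral mu F) <= M * K.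
Proof.
have [K1 h1] := norm_charge_integral_le (re_measure mu).
have [K2 h2] := norm_charge_integral_le (im_measure mu).
(* Real and imaginary parts of the integral each involve both charges. *)
exists (K1 + K2 + (K1 + K2)) => F M [f1 f2 _] fM.
have fr z := le_trans (norm_Re_le (F z)) (fM z).
have fi z := le_trans (norm_Im_le (F z)) (fM z).
rewrite /complex_integral /norm1 /= mulrDr; apply: lerD; rewrite mulrDr.
  by apply: le_trans (ler_normB _ _) _; apply: lerD; [exact: h1|exact: h2].
by apply: le_trans (ler_normD _ _) _; apply: lerD; [exact: h1|exact: h2].
Qed.

Lemma is_dq_moments A (t : times R D) gamma : times_summable t ->
  is_dq (within A (0 : R[i])^') id
    (fun h => deformed_moments mu (shift_time t gamma h))
    (deformed_moments mu t) (mmul (Upsilon gamma) (deformed_moments mu t)).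
Proof.
move=> /times_summable_bounded[C tC] b c; rewrite mmul_Upsilonl.
have [K IK] := norm1_complex_integral.
pose F0 z := monomial b z * (monomial c z)^* * cexp (tfun t z).
have gt := bounded_meas_tfun tC.
have gbc : bounded_meas (fun z => monomial b z * (monomial c z)^*).
  by apply: bounded_measM; [exact: bounded_meas_monomial|apply: bounded_meas_conj; exact: bounded_meas_monomial].
have gF0 : bounded_meas F0 by apply: bounded_measM => //; exact: bounded_meas_cexp.
have [_ _ [M F0M]] := gF0.
have M0 : 0 <= M.
  by apply: le_trans (F0M (SigSub (@torus_one R D))); exact: norm1_ge0.
(* As [norm1] of a monomial is at most [2], [norm1 h < 1 / 4] puts [w = h z^gamma] in the range of
   [cexp_remainder], whose bound [4 (2 norm1 h)^2] yields the [16]. *)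
apply: (@cvg_quotient _ _ (M * 16 * K) (1 / 4)) => // h _ h4.
have h1 : norm1 h <= 1 by lra.
pose F1 z := monomial b z * (monomial c z)^* * cexp (tfun (shift_time t gamma h) z).
pose F2 z := monomial (b + gamma) z * (monomial c z)^* * cexp (tfun t z).
have gF1 : bounded_meas F1.
  apply: bounded_measM => //; apply: bounded_meas_cexp; apply: bounded_meas_tfun.
  exact: shift_time_bounded tC h1.
have gF2 : bounded_meas F2.
  apply: bounded_measM; last exact: bounded_meas_cexp.
  by apply: bounded_measM; [exact: bounded_meas_monomial|apply: bounded_meas_conj; exact: bounded_meas_monomial].
have E : complex_integral mu F1 - complex_integral mu F0 -
    h * complex_integral mu F2 =
    complex_integral mu (fun z => F1 z + (-1) * F0 z + (- h) * F2 z).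
  rewrite complex_integralD; first last.
  - by apply: bounded_measM => //; exact: bounded_meas_cst.
  - by apply: bounded_measD => //; apply: bounded_measM => //; exact: bounded_meas_cst.
  rewrite complex_integralD //; last by apply: bounded_measM => //; exact: bounded_meas_cst.
  by rewrite !complex_integralZ // mulN1r mulNr.
rewrite /deformed_moments /moment_matrix -/F0 -/F1 -/F2 E.
rewrite [leRHS](_ : _ = M * (16 * norm1 h ^+ 2) * K); last by ring.
apply: IK.
  apply: bounded_measD; last by apply: bounded_measM => //; exact: bounded_meas_cst.
  by apply: bounded_measD => //; apply: bounded_measM => //; exact: bounded_meas_cst.
move=> z; pose w := h * monomial gamma z.
have w2 : norm1 w <= norm1 h * 2.
  apply: le_trans (norm1M _ _) _; apply: ler_wpM2l; first exact: norm1_ge0.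
  exact: norm1_monomial.
(* The shift of the time multiplies the density by [cexp w], and [h * F2 = w * F0]. *)
have -> : F1 z + -1 * F0 z + - h * F2 z = F0 z * (cexp w - 1 - w).
  rewrite /F1 /F2 /F0 (tfun_shift_time _ _ _ tC) cexpD monomialD /w; ring.
apply: le_trans (norm1M _ _) _; apply: ler_pM => //; try exact: norm1_ge0.
apply: le_trans (cexp_remainder _) _; first by lra.
have := norm1_ge0 w; have := norm1_ge0 h; rewrite !expr2; nra.
Qed.

End Linear.

End TorusIntegration.

(** * Wave, Lax and zero-curvature equations *)

Section JacobiMatrices.
Context {R : realType} {D : nat} (S : smx R D).
Hypothesis uS : blower_uni S.
Implicit Types alpha beta : midx D.

(** [jacobi] at one fixed time, with the locked product; once [smulE] is rewritten, the two are
    convertible. *)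
Definition jacobi_of (A : smx R D) alpha : smx R D :=
  mmul (mmul A (Upsilon alpha)) (sinv A).

Let rS := blower_uni_rfin uS.
Let rT := sinv_rfin uS.
Let TS : mmul (sinv S) S = sone. Proof. by have [] := sinvP uS. Qed.
Let rU := @Upsilon_rfin R D.

Lemma jacobi_of_rfin alpha : rfin (jacobi_of S alpha).
Proof. exact: rfin_mmul (rfin_mmul rS (rU alpha)) rT. Qed.

Lemma jacobi_of_mmul alpha : mmul (jacobi_of S alpha) S = mmul S (Upsilon alpha).
Proof. by rewrite /jacobi_of (mmulA _ (rfin_mmul rS (rU alpha)) rT) TS mmulx1. Qed.

Lemma jacobi_of_comm alpha beta :
  mmul (jacobi_of S alpha) (jacobi_of S beta) =
  mmul (jacobi_of S beta) (jacobi_of S alpha).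
Proof. exact: similar_comm rS rT (rU alpha) (rU beta) TS (UpsilonC _ _). Qed.

Lemma jacobi_of_zero_curvature alpha beta (J := jacobi_of S alpha)
    (J' := jacobi_of S beta) :
  supper (scomm (supper J') J) - supper (scomm (supper J) J') +
  scomm (supper J) (supper J') = 0.
Proof.
exact: zero_curvature (jacobi_of_rfin alpha) (jacobi_of_rfin beta)
  (jacobi_of_comm alpha beta).
Qed.

End JacobiMatrices.

Section LeftWaves.
Context {R : realType} {D : nat}.
Local Open Scope complex_scope.
Context {F : set_system R[i]} {FF : Filter F}.
Variable q : R[i] -> R[i].
Hypothesis q0 : q @ F --> (0 : R[i]).
Hypothesis qN0 : \forall h \near F, q h != 0.
Variables (S H hS G W : R[i] -> smx R D) (S0 H0 hS0 G0 W0 : smx R D).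
Variable gamma : midx D.
Hypothesis gb : \forall h \near F, gauss_borel (G h) (S h) (H h) (hS h).
Hypothesis gb0 : gauss_borel G0 S0 H0 hS0.
Hypothesis dG : is_dq F q G G0 (mmul (Upsilon gamma) G0).

Let uS0 : blower_uni S0. Proof. by case: gb0. Qed.
Let uS : \forall h \near F, blower_uni (S h).
Proof. by apply: filterS gb => h []. Qed.
Let uSG : \forall h \near F, upper (mmul (S h) (G h)).
Proof. by apply: filterS gb => h; exact: gauss_borel_upper. Qed.

Lemma is_dq_left_wave : is_dq F q W W0 (mmul (Upsilon gamma) W0) ->
  is_dq F q (fun h => mmul (S h) (W h)) (mmul S0 W0)
    (mmul (supper (jacobi_of S0 gamma)) (mmul S0 W0)).
Proof.
have [V uV SGV] := gauss_borel_rinv gb0.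
exact: (is_dq_wave (FF := FF) q0 qN0 uS uS0 uSG uV SGV (@Upsilon_rfin R D gamma)
  (jacobi_of_rfin uS0 gamma) (jacobi_of_mmul uS0 gamma) dG).
Qed.

Lemma is_dq_lax alpha :
  is_dq F q (fun h => jacobi_of (S h) alpha) (jacobi_of S0 alpha)
    (scomm (supper (jacobi_of S0 gamma)) (jacobi_of S0 alpha)).
Proof.
have [V uV SGV] := gauss_borel_rinv gb0.
exact: (is_dq_jacobi (FF := FF) q0 qN0 uS uS0 uSG uV SGV (@Upsilon_rfin R D gamma)
  (jacobi_of_rfin uS0 gamma) (jacobi_of_mmul uS0 gamma) dG erefl (jacobi_of_comm uS0 gamma alpha)).
Qed.

End LeftWaves.

Section RightWaves.
Context {R : realType} {D : nat}.
Local Open Scope complex_scope.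
Context {F : set_system R[i]} {FF : Filter F}.
Variable q : R[i] -> R[i].
Hypothesis q0 : q @ F --> (0 : R[i]).
Hypothesis qN0 : \forall h \near F, q h != 0.
Variables (S H hS G : R[i] -> smx R D) (S0 H0 hS0 G0 : smx R D).
Variable gamma : midx D.
Hypothesis gb : \forall h \near F, gauss_borel (G h) (S h) (H h) (hS h).
Hypothesis gb0 : gauss_borel G0 S0 H0 hS0.
Hypothesis dG : is_dq F q G G0 (mmul (Upsilon gamma) G0).

Lemma is_dq_right_wave :
  is_dq F q (fun h => mmul (H h) (sadj (sinv (hS h)))) (mmul H0 (sadj (sinv hS0)))
    (mmul (supper (jacobi_of S0 gamma)) (mmul H0 (sadj (sinv hS0)))).
Proof.
rewrite -(gauss_borel_lsolve gb0) => b c.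
(* [dG] serves twice: it yields the derivative of [S], and it is the equation of the right factor
   [W = G]. *)
have dU := is_dq_left_wave (FF := FF) q0 qN0 gb gb0 dG dG.
refine (near_eq_cvgC (FF := FF) _ (@dU b c)).
by apply: filterS gb => h gbh; rewrite (gauss_borel_lsolve gbh).
Qed.

End RightWaves.

(* Taking adjoints turns [d/dt_(-alpha)] into [d/d(conj t_(-alpha))], and the
   adjoint of [Upsilon (- alpha)] is [Upsilon alpha]. *)
Lemma is_dq_sadj (R : realType) (D : nat) (T : set R[i]) (A : R[i] -> smx R D)
    (A0 L : smx R D) :
  is_dq (within T (0 : R[i])^') id A A0 L ->
  is_dq (within T (0 : R[i])^') (fun h => conjc h) (fun h => sadj (A h)) (sadj A0)
    (sadj L).
Proof.
move=> dA b c; refine (near_eq_cvgC _ (cvgC_conj (@dA c b))).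
by apply: filterE => h; rewrite rmorphM rmorphB fmorphV.
Qed.

Section Adjoint.
Context {R : realType} {D : nat}.
Implicit Types (t : times R D).

(** On the torus conjugation inverts monomials, so at [b, c] both sides are the conjugate of the
    same integral, with monomial [z^(c - alpha - b)]. *)
Lemma sadj_Upsilon_moments (mu : complex_measure R D) t alpha :
  sadj (mmul (Upsilon (- alpha)) (deformed_moments mu t)) =
  mmul (Upsilon alpha) (sadj (deformed_moments mu t)).
Proof.
apply/funext => b; apply/funext => c.
rewrite /sadj !mmul_Upsilonl /deformed_moments /moment_matrix.
congr (conjc (complex_integral mu _)); apply/funext => z.
by congr (_ * _); exact: monomial_shift.
Qed.

Lemma sadj_Upsilon_W0 t alpha : times_summable t ->
  sadj (mmul (Upsilon (- alpha)) (W0 t)) = mmul (Upsilon alpha) (sadj (W0 t)).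
Proof.
move=> /times_summable_bounded[C tC]; apply/funext => b; apply/funext => c.
rewrite /sadj !mmul_Upsilonl -(@W0_shift _ _ t C _ _ alpha tC) subrK.
by [].
Qed.

End Adjoint.

Theorem proposition4p7 (R : realType) (D : nat) (hD : (0 < D)%N)
    (mu : complex_measure R D) (S H hS : times R D -> smx R D)
    (hfact : forall t : times R D, admissible mu t ->
       gauss_borel (deformed_moments mu t) (S t) (H t) (hS t)) :
  forall t : times R D, admissible mu t -> forall alpha alpha' : midx D,
  let J := jacobi S in
  let hJ := jacobi hS in
  let B := zakharov_shabat S in
  let hB := zakharov_shabat hS in
  let dt := is_dt (admissible mu) in
  let dtbar := is_dtbar (admissible mu) in
  [/\ (* linear systems for the wave matrices *)
      [/\ dt (wave1 S) alpha t (smul (B alpha t) (wave1 S t)),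
          dtbar (hwave1 hS) (- alpha) t (smul (hB alpha t) (hwave1 hS t)),
          dt (hwave2 H hS) alpha t (smul (B alpha t) (hwave2 H hS t))
        & dtbar (wave2 S H) (- alpha) t (smul (hB alpha t) (wave2 S H t))],
      (* Lax equations *)
      dt (J alpha) alpha' t (scomm (B alpha' t) (J alpha t)) /\
      dtbar (hJ alpha) (- alpha') t (scomm (hB alpha' t) (hJ alpha t))
    & (* zero-curvature equations *)
      (exists dB dB' : smx R D,
        [/\ dt (B alpha) alpha' t dB, dt (B alpha') alpha t dB'
          & forall b c,
              dB b c - dB' b c + scomm (B alpha t) (B alpha' t) b c = 0]) /\
      (exists dhB dhB' : smx R D,
        [/\ dtbar (hB alpha) (- alpha') t dhB,
            dtbar (hB alpha') (- alpha) t dhB'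
          & forall b c,
              dhB b c - dhB' b c + scomm (hB alpha t) (hB alpha' t) b c = 0])].
Proof.
move=> t adt alpha alpha' J hJ B hB dt dtbar.
have ts : times_summable t by case: adt.
have gb0 := hfact t adt; have hgb0 := gauss_borel_sadj gb0.
pose T gamma := [set h : R[i] | admissible mu (shift_time t gamma h)].
pose F gamma := within (T gamma) (0 : R[i])^'.
have FF gamma : Filter (F gamma) by exact: within_filter.
have q0 gamma : id @ F gamma --> (0 : R[i]) by exact: within_dnbhs0_cvg.
have qN gamma : \forall h \near F gamma, id h != 0 by exact: within_dnbhs0_neq.
have p0 gamma : (fun h : R[i] => conjc h) @ F gamma --> (0 : R[i]).
  by have h := cvgC_conj (q0 gamma); rewrite conjc0 in h; exact: h.
have pN gamma : \forall h \near F gamma, conjc h != 0.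
  by apply: filterS (qN gamma) => h; rewrite conjc_eq0.
have gb gamma : \forall h \near F gamma, gauss_borel
    (deformed_moments mu (shift_time t gamma h)) (S (shift_time t gamma h))
    (H (shift_time t gamma h)) (hS (shift_time t gamma h)).
  by apply: filterS (near_within_dnbhs0 (T gamma) ltr01) => h [Th _ _]; exact: hfact.
have hgb gamma : \forall h \near F gamma, gauss_borel
    (sadj (deformed_moments mu (shift_time t gamma h))) (hS (shift_time t gamma h))
    (sadj (H (shift_time t gamma h))) (S (shift_time t gamma h)).
  by apply: filterS (gb gamma) => h; exact: gauss_borel_sadj.
have dG gamma := @is_dq_moments R D mu (T gamma) t gamma ts.
have dW gamma := @is_dq_W0 R D (T gamma) t gamma ts.
have hdG gamma := is_dq_sadj (dG (- gamma)).
have hdW gamma := is_dq_sadj (dW (- gamma)).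
have {}hdG gamma : is_dq (F (- gamma)) (fun h : R[i] => conjc h)
    (fun h => sadj (deformed_moments mu (shift_time t (- gamma) h)))
    (sadj (deformed_moments mu t))
    (mmul (Upsilon gamma) (sadj (deformed_moments mu t))).
  by rewrite -sadj_Upsilon_moments; exact: hdG.
have {}hdW gamma : is_dq (F (- gamma)) (fun h : R[i] => conjc h)
    (fun h => sadj (W0 (shift_time t (- gamma) h)))
    (sadj (W0 t)) (mmul (Upsilon gamma) (sadj (W0 t))).
  by rewrite -sadj_Upsilon_W0 //; exact: hdW.
have lax (a g : midx D) :=
  is_dq_lax (alpha := a) (FF := FF g) (q0 g) (qN g) (gb g) gb0 (dG g).
have hlax (a g : midx D) := is_dq_lax (alpha := a) (FF := FF (- g))
  (p0 (- g)) (pN (- g)) (hgb (- g)) hgb0 (hdG g).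
rewrite /dt /dtbar /J /hJ /B /hB /is_dt /is_dtbar /wave1 /hwave1 /wave2 /hwave2
  /zakharov_shabat /jacobi smulE.
split.
- split.
  + exact: (is_dq_left_wave (FF := FF _) (q0 alpha) (qN alpha) (gb alpha) gb0 (dG alpha) (dW alpha)).
  (* In the factorization of the adjoint, [hS] is the left factor, and [hwave1] is [hS] times
     [sadj (W0 t)]. *)
  + exact: (is_dq_left_wave (FF := FF _) (p0 (- alpha)) (pN (- alpha)) (hgb (- alpha)) hgb0
      (hdG alpha) (hdW alpha)).
  + exact: (is_dq_right_wave (FF := FF _) (q0 alpha) (qN alpha) (gb alpha) gb0 (dG alpha)).
  (* [wave2] is the product of the last two factors in the factorization of the adjoint. *)
  + exact: (is_dq_right_wave (FF := FF _) (p0 (- alpha)) (pN (- alpha)) (hgb (- alpha)) hgb0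
      (hdG alpha)).
- by split; [exact: lax|exact: hlax].
split.
(* Truncation to the upper part is entrywise, so the derivatives of the Zakharov-Shabat matrices are
   the upper parts of the Lax right-hand sides. *)
- exists (supper (scomm (supper (jacobi_of (S t) alpha')) (jacobi_of (S t) alpha))).
  exists (supper (scomm (supper (jacobi_of (S t) alpha)) (jacobi_of (S t) alpha'))).
  split.
  + exact: (is_dq_supper (FF := FF alpha') (lax alpha alpha')).
  + exact: (is_dq_supper (FF := FF alpha) (lax alpha' alpha)).
  move=> b c; have uS : blower_uni (S t) by case: gb0.
  exact: (congr1 (fun X : smx R D => X b c) (jacobi_of_zero_curvature uS alpha alpha')).
exists (supper (scomm (supper (jacobi_of (hS t) alpha')) (jacobi_of (hS t) alpha))).
exists (supper (scomm (supper (jacobi_of (hS t) alpha)) (jacobi_of (hS t) alpha'))).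
split.
+ exact: (is_dq_supper (FF := FF (- alpha')) (hlax alpha alpha')).
+ exact: (is_dq_supper (FF := FF (- alpha)) (hlax alpha' alpha)).
move=> b c; have uS : blower_uni (hS t) by case: gb0.
exact: (congr1 (fun X : smx R D => X b c) (jacobi_of_zero_curvature uS alpha alpha')).
Qed.
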